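(* (Leray–Schauder continuation theorem for weak topologies) Let $E$ be a Banach space which is weakly normal and $w^*$-separable, let $U\subset E$ be weakly open and let $x_0\in U$. Let $F\colon(\overline{U}^w,w)\multimap(E,w)$ be a sequentially upper semicontinuous multimap with nonempty weakly compact convex values such that (a) $\bigcup_{\lambda\in[0,1]}\{x\in\overline{U}^w: x\in(1-\lambda)x_0+\lambda F(x)\}$ is relatively weakly compact; (b) for every $M\subset\overline{U}^w$ with $M\subset\overline{\operatorname{co}}(\{x_0\}\cup F(M))$, the set $M$ is relatively weakly compact; (c) for every $x\in\overline{U}^w\setminus U$ and every $\lambda\in[0,1]$, $x\notin(1-\lambda)x_0+\lambda F(x)$. Then $F$ has a fixed point, i.e. $\operatorname{Fix}(F)\neq\varnothing$.
   Context: $\overline{U}^w$ is the weak closure of $U$; $(X,w)$ denotes $X$ with the relative weak topology. $E$ is weakly normal if $(E,\sigma(E,E^* ))$ is a normal topological space, and $w^*$-separable means that the dual $E^*$ is separable in the weak$^*$ topology. Sequential upper semicontinuity is with respect to the weak topologies on domain and target. $\overline{\operatorname{co}}$ denotes closed convex hull. *)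

(* Defs.v *)
From HB Require Import structures.
From mathcomp Require Import all_boot all_order all_algebra.
From mathcomp Require Import all_classical all_reals all_analysis.
From Stdlib Require List.
Import List (In).
Set Implicit Arguments. Unset Strict Implicit. Unset Printing Implicit Defensive.
Import Order.TTheory GRing.Theory Num.Theory.
Import numFieldNormedType.Exports.
Local Open Scope classical_set_scope.
Local Open Scope ring_scope.

Definition Wdual_fun (R : realType) (E : normedModType R) (f : E -> R) : Prop :=
  (forall (a : R) (x y : E), f (a *: x + y) = a * f x + f y) /\ continuous f.

Definition Wwball (R : realType) (E : normedModType R) (x : E) (n : nat)
  (fs : nat -> E -> R) (eps : R) : set E :=
  [set y | forall i, (i < n)%N -> `|fs i y - fs i x| < eps].

Definition Wwopen (R : realType) (E : normedModType R) (U : set E) : Prop :=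
  forall x, U x -> exists n (fs : nat -> E -> R) (eps : R),
    [/\ (forall i, Wdual_fun (fs i)), 0 < eps & Wwball x n fs eps `<=` U].

Definition Wwclosed (R : realType) (E : normedModType R) (A : set E) : Prop :=
  Wwopen (~` A).

Definition Wwclosure (R : realType) (E : normedModType R) (A : set E) : set E :=
  [set x | forall n (fs : nat -> E -> R) (eps : R),
     (forall i, Wdual_fun (fs i)) -> 0 < eps -> Wwball x n fs eps `&` A !=set0].

Definition Wwcompact (R : realType) (E : normedModType R) (A : set E) : Prop :=
  forall (I : Type) (G : I -> set E), (forall i, Wwopen (G i)) ->
    A `<=` \bigcup_i G i ->
    exists s : seq I, A `<=` [set x | exists2 i, In i s & G i x].

Definition Wrel_wcompact (R : realType) (E : normedModType R) (A : set E) : Prop :=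
  Wwcompact (Wwclosure A).

(* (E, sigma(E,E^star)) is a normal space (it is always Hausdorff). *)
Definition Wweakly_normal (R : realType) (E : normedModType R) : Prop :=
  forall A B : set E, Wwclosed A -> Wwclosed B -> A `&` B = set0 ->
    exists U V : set E, [/\ Wwopen U, Wwopen V, A `<=` U, B `<=` V & U `&` V = set0].

Definition Wwstar_separable (R : realType) (E : normedModType R) : Prop :=
  exists d : nat -> E -> R, (forall k, Wdual_fun (d k)) /\
    forall f, Wdual_fun f -> forall (m : nat) (xs : nat -> E) (eps : R), 0 < eps ->
      exists k, forall i, (i < m)%N -> `|d k (xs i) - f (xs i)| < eps.

Definition Wwcvg (R : realType) (E : normedModType R) (u : nat -> E) (x : E) : Prop :=
  forall f, Wdual_fun f -> (fun k => f (u k)) @ \oo --> f x.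

Definition Wseq_usc (R : realType) (E : normedModType R) (D : set E)
  (F : E -> set E) : Prop :=
  forall C : set E, Wwclosed C -> forall (u : nat -> E) (x : E),
    (forall k, D (u k)) -> D x -> (forall k, F (u k) `&` C !=set0) ->
    Wwcvg u x -> F x `&` C !=set0.

Definition Wconvex (R : realType) (E : normedModType R) (A : set E) : Prop :=
  forall (x y : E) (t : R), A x -> A y -> 0 <= t <= 1 -> A (t *: x + (1 - t) *: y).

Definition Wclconv (R : realType) (E : normedModType R) (A : set E) : set E :=
  [set x | forall C : set E, closed C -> Wconvex C -> A `<=` C -> C x].

(* Main.v *)
(* Let [S] be the set of all solutions of x \in (1 - l) x0 + l F x, l \in [0, 1].
   Weak normality gives a weakly continuous [th] equal to 1 on [S] and to 0 off
   [U]; a fixed point of the damped multimap Phi x = (1 - th x) x0 + th x F x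
   lies in [S], where Phi = F.  Let [M] be the least convex set that contains
   [x0] and is stable under Phi.  By (b), the part of [M] in the weak closure of
   [U] is relatively weakly compact, and a countable weak*-dense family of
   functionals makes weakly compact sets sequentially compact.

   Neither Krein-Smulian nor Brouwer is needed.  Every functional is bounded on
   Phi(M), so Phi(M) has finite nets for finitely many functionals [h], and
   Scarf's combinatorial lemma, applied to finer and finer grids of the simplex
   spanned by such a net, gives x \in M and y \in Phi x with [h x] close to
   [h y].  Such approximate fixed points eventually lie in [U], hence in a
   sequentially compact set, and a subsequence converges to a fixed point. *)
From HB Require Import structures.
From mathcomp Require Import all_boot zify.
Set Implicit Arguments. Unset Strict Implicit. Unset Printing Implicit Defensive.

(** * Scarf's lemma *)

Section Scarf.
Variables (T I : finType) (r : I -> T -> nat) (c : T -> I).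
Hypothesis r_inj : forall i, injective (r i).

(** Scarf's dominance: no point of [T] lies above the minimum of [s] in all the orders indexed by
    [C] at once. *)
Definition dominant (s : {set T}) (C : {set I}) :=
  [forall y, [exists i in C, [forall x in s, r i y <= r i x]]].

Lemma dominantP (s : {set T}) (C : {set I}) :
  reflect (forall y, exists2 i, i \in C & forall x, x \in s -> r i y <= r i x)
          (dominant s C).
Proof.
apply: (iffP forallP) => H y.
  by have /exists_inP[i iC /forall_inP h] := H y; exists i.
have [i iC h] := H y; apply/exists_inP; exists i => //.
exact/forall_inP.
Qed.

Lemma dominantS (s s' : {set T}) (C C' : {set I}) :
  s' \subset s -> C \subset C' -> dominant s C -> dominant s' C'.
Proof.
move=> /subsetP ss /subsetP CC /dominantP H; apply/dominantP => y.
by have [i iC h] := H y; exists i => [|x /ss]; [exact: CC|exact: h].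
Qed.

(** * Pivoting: the rooms on either side of a door *)

Section DoorDegree.
Variables (t : {set T}) (D : {set I}).
Hypotheses (cardD : #|D| = #|t|.+1) (domt : dominant t D).

(** The witnesses against dominance of [t] by [D :\ e]. A pivot that frees [e] brings in the largest
    of them for [r e]. *)
Definition beyond (e : I) : {set T} :=
  [set y | [forall k in D :\ e, [exists x in t, r k x < r k y]]].

Lemma beyondP e y : reflect
  (forall k, k \in D -> k != e -> exists2 x, x \in t & r k x < r k y)
  (y \in beyond e).
Proof.
rewrite inE; apply: (iffP forall_inP) => H k.
  move=> kD ke; have kDe : k \in D :\ e by rewrite in_setD1 ke.
  by have /exists_inP[x] := H k kDe; exists x.
rewrite in_setD1 => /andP[ke kD]; have [x xt h] := H k kD ke.
by apply/exists_inP; exists x.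
Qed.

Lemma dominant_beyond0 e : dominant t (D :\ e) = (beyond e == set0).
Proof.
apply/dominantP/eqP => [H|b0 y].
  apply/setP => y; rewrite [RHS]inE; apply/beyondP => H'.
  have [k] := H y; rewrite in_setD1 => /andP[ke kD] h.
  by have [x /h + lt] := H' k kD ke; rewrite leqNgt lt.
have : y \notin beyond e by rewrite b0 inE.
rewrite inE negb_forall => /existsP[k]; rewrite negb_imply => /andP[kD].
move=> /exists_inPn h; exists k => // x /h; by rewrite -leqNgt.
Qed.

(** Each point of [t] is least for some order in [D :\ e], the order [e] being taken by [x]. Since
    [#|D| = #|t|.+1], this choice of orders is a bijection, so every order other than [e] has its
    minimum in [t], strictly below [x]. *)
Lemma dominant_setU1 e x : e \in D -> x \notin t -> dominant (x |: t) D ->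
  (forall y, y \in t -> r e x <= r e y) ->
  (x \in beyond e) /\ (forall y, y \in beyond e -> r e y <= r e x) /\
  (forall y, y \in t -> exists2 k, k \in D :\ e & forall z, z \in t -> r k y <= r k z).
Proof.
move=> eD xt /dominantP dom xe.
have surj y : y \in t -> exists2 k, k \in D :\ e & forall z, z \in x |: t -> r k y <= r k z.
  move=> yt; have [k kD h] := dom y; exists k => //; rewrite in_setD1 kD andbT.
  apply/eqP => ke; have := h x (setU11 _ _); rewrite ke => yx.
  have /r_inj xy : r e x = r e y by apply/eqP; rewrite eqn_leq yx xe.
  by rewrite xy yt in xt.
split; last first.
  split=> [y /beyondP yb|y /surj[k kD h]]; last by exists k => // z zt; apply/h/setU1r.
  have [k kD h] := dom y; have [<-|ke] := eqVneq k e; first exact/h/setU11.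
  by have [z zt] := yb k kD ke; rewrite ltnNge h// setU1r.
pose f y := odflt e [pick k in D :\ e | [forall z in x |: t, r k y <= r k z]].
have fP y : y \in t -> f y \in D :\ e /\ forall z, z \in x |: t -> r (f y) y <= r (f y) z.
  move=> /surj[k kD h]; rewrite /f; case: pickP => [k' /andP[k'D /forall_inP]//|].
  by move=> /(_ k); rewrite kD /=; move=> /negbT/negP[]; apply/forall_inP.
have finj : {in t &, injective f}.
  move=> y z yt zt fyz; apply: (@r_inj (f y)); apply/eqP.
  have [_ hy] := fP y yt; have [_ hz] := fP z zt.
  by rewrite eqn_leq hy ?setU1r//= fyz hz // setU1r.
have fim : f @: t = D :\ e.
  apply/eqP; rewrite eqEcard; apply/andP; split.
    by apply/subsetP => _ /imsetP[y yt ->]; have [] := fP y yt.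
  by rewrite card_in_imset // -ltnS -cardD (cardsD1 e D) eD.
apply/beyondP => k kD ke.
have : k \in f @: t by rewrite fim in_setD1 ke.
case/imsetP => y yt ->; exists y => //; have [_ hy] := fP y yt.
rewrite ltn_neqAle hy ?setU11// andbT; apply/eqP => /r_inj xy.
by rewrite -xy yt in xt.
Qed.

Definition room_of (e : I) : {set T} * {set I} :=
  if [pick x in beyond e] is Some x
  then ([arg max_(y > x in beyond e) r e y] |: t, D) else (t, D :\ e).

(** The added point keeps dominance: a [y] in [beyond e] can only be dominated through [e], where
    the new point is maximal, and any other [y] is dominated through some [k != e], where the new
    point lies above a point of [t]. *)
Lemma room_ofP e : e \in D ->
  (forall y, y \in t -> exists2 k, k \in D :\ e & forall z, z \in t -> r k y <= r k z) ->
  (beyond e = set0 /\ room_of e = (t, D :\ e) /\ dominant t (D :\ e)) \/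
  exists x, [/\ x \in beyond e, forall y, y \in beyond e -> r e y <= r e x,
    x \notin t, room_of e = (x |: t, D) & dominant (x |: t) D].
Proof.
move=> eD surj; rewrite /room_of; case: pickP => [x0 x0b|b0]; last first.
  have b0' : beyond e = set0 by apply/setP => y; rewrite b0 inE.
  by left; split=> //; split=> //; rewrite dominant_beyond0 b0'.
right; case: arg_maxnP => // x xb xmax; exists x.
have nbt y : y \in t -> y \notin beyond e.
  move=> yt; apply/negP => /beyondP yb; have [k] := surj y yt.
  rewrite in_setD1 => /andP[ke kD] h; have [z /h + lt] := yb k kD ke.
  by rewrite leqNgt lt.
split=> //; first by apply: contraL xb; exact: nbt.
apply/dominantP => y; have [yb|] := boolP (y \in beyond e).
  have /dominantP/(_ y)[k kD h] := domt.
  have ke : k = e.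
    apply/eqP/negPn/negP => ke; have /beyondP/(_ k kD ke)[z /h + lt] := yb.
    by rewrite leqNgt lt.
  by subst k; exists e => // z /setU1P[->|/h//]; exact: xmax.
rewrite inE negb_forall => /existsP[k]; rewrite negb_imply in_setD1.
move=> /andP[/andP[ke kD] /exists_inPn h]; exists k => // z /setU1P[->|/h]; last by rewrite -leqNgt.
have /beyondP/(_ k kD ke)[w wt lt] := xb; have := h w wt.
by rewrite -leqNgt => /leq_trans; apply; exact: ltnW.
Qed.

Definition adjacent_rooms : {set {set T} * {set I}} :=
  [set p | dominant p.1 p.2 &&
    ([exists k in D, p == (t, D :\ k)] || [exists x in ~: t, p == (x |: t, D)])].

(** Sending an order to its minimiser maps [D] onto [t], and [D] has one element more, so exactly
    one pair [i], [j] shares a minimiser. Only these two orders can be freed, and each of them leads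
    to one room. *)
Lemma inner_door_degree : t != set0 -> #|adjacent_rooms| = 2.
Proof.
case/set0Pn => x0 x0t.
pose m k := [arg min_(x < x0 in t) r k x].
have mP k : m k \in t /\ forall x, x \in t -> r k (m k) <= r k x.
  by rewrite /m; case: arg_minnP.
have mE k y : y \in t -> (forall x, x \in t -> r k y <= r k x) -> m k = y.
  move=> yt h; have [mt mm] := mP k; apply: (@r_inj k).
  by apply/eqP; rewrite eqn_leq h // mm.
have mD : m @: D = t.
  apply/setP => y; apply/imsetP/idP => [[k _ ->]|yt]; first by have [] := mP k.
  by have /dominantP/(_ y)[k kD h] := domt; exists k => //; rewrite (mE k y).
have /dinjectivePn[i iD [j /andP[ji jD] mij]] : ~~ dinjectiveb m D.
  apply/dinjectiveP => /card_in_imset; rewrite mD => e.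
  by move: cardD; rewrite -e => /n_Sn.
have mDe e e' : e \in D -> e' \in D -> e' != e -> m e = m e' ->
    m @: (D :\ e) = t /\ {in D :\ e &, injective m}.
  move=> eD e'D ne me; have im : m @: (D :\ e) = t.
    rewrite -mD; apply/setP => y; apply/imsetP/imsetP => -[k].
      by rewrite in_setD1 => /andP[_ kD] ->; exists k.
    move=> kD ->; have [->|ke] := eqVneq k e; last by exists k; rewrite ?in_setD1 ?ke.
    by exists e'; rewrite ?in_setD1 ?ne.
  split=> //; apply/imset_injP; rewrite im; apply/eqP.
  by move: cardD; rewrite (cardsD1 e D) eD => -[].
have [imi inji] := mDe i j iD jD ji mij.
have ij : i != j by rewrite eq_sym.
have [imj injj] := mDe j i jD iD ij (esym mij).
have surj e : m @: (D :\ e) = t ->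
    forall y, y \in t -> exists2 k, k \in D :\ e & forall z, z \in t -> r k y <= r k z.
  move=> im y; rewrite -{1}im => /imsetP[k kD ->]; exists k => // z zt.
  by have [_] := mP k; apply.
(* Freeing an order outside the pair would leave its minimiser [m k] least for no remaining
   order. *)
have only k : k \in D -> (forall y, y \in t ->
    exists2 k', k' \in D :\ k & forall z, z \in t -> r k' y <= r k' z) -> k = i \/ k = j.
  move=> kD H; have [->|ki] := eqVneq k i; [by left|right].
  apply/eqP/negPn/negP => kj.
  have [mkt _] := mP k; have [k'] := H _ mkt; rewrite in_setD1 => /andP[k'k k'D] h.
  have mk : m k' = m k by exact: mE.
  have [k'i|k'i] := eqVneq k' i.
    have := inji k j; rewrite !in_setD1 ki ji kD jD -mij -k'i mk.
    by move=> /(_ isT isT erefl) /eqP; rewrite (negPf kj).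
  have := inji k' k; rewrite !in_setD1 k'i ki k'D kD mk.
  by move=> /(_ isT isT erefl) /eqP; rewrite (negPf k'k).
have -> : adjacent_rooms = [set room_of i; room_of j].
  apply/setP => p; rewrite !inE; apply/idP/idP.
    move=> /andP[dom /orP[/exists_inP[k kD /eqP pE]|/exists_inP[x xt /eqP pE]]]; subst p => /=.
      move: dom => /= dom.
      have [] : k = i \/ k = j.
        apply: only => // y yt; have /dominantP/(_ y)[k' k'D h] := dom.
        by exists k'.
      - move=> ki; subst k; case: (room_ofP iD (surj i imi)) => [[_ [-> _]]|]; first by rewrite eqxx.
        by case=> x []; move: dom; rewrite dominant_beyond0 => /eqP ->; rewrite inE.
      move=> ki; subst k; case: (room_ofP jD (surj j imj)) => [[_ [-> _]]|]; first by rewrite eqxx orbT.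
      by case=> x []; move: dom; rewrite dominant_beyond0 => /eqP ->; rewrite inE.
    move: dom xt => /= dom; rewrite in_setC => xt.
    have /dominantP/(_ x)[e eD xe] := dom.
    have xe' y : y \in t -> r e x <= r e y by move=> yt; apply/xe/setU1r.
    have [xb [xmax /(only _ eD)]] := dominant_setU1 eD xt dom xe'.
    move=> []E; subst e.
    - case: (room_ofP iD (surj i imi)) => [[b0]|[y [yb ymax _ -> _]]]; first by rewrite b0 inE in xb.
      have /r_inj -> : r i x = r i y by apply/eqP; rewrite eqn_leq xmax// ymax.
      by rewrite eqxx.
    case: (room_ofP jD (surj j imj)) => [[b0]|[y [yb ymax _ -> _]]]; first by rewrite b0 inE in xb.
    have /r_inj -> : r j x = r j y by apply/eqP; rewrite eqn_leq xmax// ymax.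
    by rewrite eqxx orbT.
  have half e : e \in D -> m @: (D :\ e) = t -> p == room_of e -> dominant p.1 p.2 &&
    ([exists k in D, p == (t, D :\ k)] || [exists x in ~: t, p == (x |: t, D)]).
    move=> eD im /eqP ->; case: (room_ofP eD (surj e im)) => [[_ [-> ->]]|[x [_ _ xt -> ->]]] /=.
      by apply/orP; left; apply/exists_inP; exists e.
    by apply/orP; right; apply/exists_inP; exists x; rewrite ?in_setC.
  by case/orP; apply: half.
rewrite cards2; suff -> : room_of i != room_of j by [].
apply/eqP.
case: (room_ofP iD (surj i imi)) => [[_ [-> _]]|[x [xb _ xt -> _]]];
  case: (room_ofP jD (surj j imj)) => [[_ [-> _]]|[y [yb _ yt -> _]]].
- by case=> /setP/(_ i); rewrite !in_setD1 eqxx iD eq_sym ji.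
- by case=> e _; rewrite e setU11 in yt.
- by case=> e _; rewrite -e setU11 in xt.
case=> e; have : x \in y |: t by rewrite -e setU11.
rewrite in_setU1 (negPf xt) orbF => /eqP xy; subst y.
(* A point brought in by both pivots is in [beyond i] and [beyond j], hence above some point of [t]
   in every order of [D], against dominance. *)
have /dominantP/(_ x)[k kD h] := domt.
have [ki|ki] := eqVneq k i.
  have kj : k != j by rewrite ki eq_sym.
  by have /beyondP/(_ k kD kj)[z /h + lt] := yb; rewrite leqNgt lt.
by have /beyondP/(_ k kD ki)[z /h + lt] := xb; rewrite leqNgt lt.
Qed.

End DoorDegree.

(** * Doors, rooms and parity *)

Variable i0 : I.

(* A door is in principle a pair [(t, D)] with [D :\: c @: t = [set i0]] and
   [#|D| = #|t|.+1]; this forces [D = i0 |: c @: t], so only [t] is recorded.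
   A room is a dominant pair [(s, C)] with [#|s| = #|C|]. *)
Definition door (t : {set T}) :=
  [&& #|c @: t| == #|t|, i0 \notin c @: t & dominant t (i0 |: c @: t)].

Definition incident (t : {set T}) (p : {set T} * {set I}) :=
  door t && (p \in adjacent_rooms t (i0 |: c @: t)).

Definition rooms_of (t : {set T}) := [set p | incident t p].
Definition doors_of (p : {set T} * {set I}) := [set t | incident t p].

(** Freeing [i0] leaves no order at all, so the only room at the empty door consists of the maximum
    of [r i0] with the index set [[set i0]]. *)
Lemma outer_door (x1 : T) : door set0 /\ odd #|rooms_of set0|.
Proof.
have d0 : door set0.
  rewrite /door imset0 !cards0 inE eqxx /=; apply/dominantP => y.
  by exists i0; rewrite ?setU11 // => x; rewrite inE.
split=> //; pose x0 := [arg max_(y > x1 in setT) r i0 y].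
have x0max y : r i0 y <= r i0 x0.
  by rewrite /x0; case: arg_maxnP => [|x _ h]; rewrite ?inE//; apply: h; rewrite inE.
suff -> : rooms_of set0 = [set ([set x0], [set i0])] by rewrite cards1.
apply/setP => -[s C]; rewrite !inE /incident d0 /= inE imset0 setU0 /=.
apply/idP/eqP => [/andP[dom /orP[/exists_inP[k]|/exists_inP[x _]]]|[-> ->]].
- rewrite inE => /eqP-> /eqP[_ CE]; move: dom => /dominantP/(_ x0)[k' + _].
  by rewrite CE !inE; case: eqP.
- rewrite setU0 => /eqP[sE CE]; subst s C; suff -> : x = x0 by [].
  apply: (@r_inj i0); apply/eqP; rewrite eqn_leq x0max.
  have /dominantP/(_ x0)[k] := dom; rewrite inE => /eqP -> -> //.
  by rewrite inE.
apply/andP; split.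
  by apply/dominantP => y; exists i0 => [|x]; rewrite inE // => /eqP->.
by apply/orP; right; apply/exists_inP; exists x0; rewrite ?inE // setU0.
Qed.

Lemma inner_door (t : {set T}) : t != set0 -> ~~ odd #|rooms_of t|.
Proof.
move=> t0; have [dt|ndt] := boolP (door t); last first.
  suff -> : rooms_of t = set0 by rewrite cards0.
  by apply/setP => p; rewrite !inE /incident (negPf ndt).
have -> : rooms_of t = adjacent_rooms t (i0 |: c @: t).
  by apply/setP => p; rewrite inE /incident dt.
case/and3P: dt => /eqP ct ict dom; rewrite inner_door_degree //.
by rewrite cardsU1 ict ct.
Qed.

Definition colourful (p : {set T} * {set I}) :=
  [&& dominant p.1 p.2, #|p.2| == #|p.1| & c @: p.1 == p.2].

Lemma rainbowP (s : {set T}) : reflect {in s &, injective c} (#|c @: s| == #|s|).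
Proof. exact: imset_injP. Qed.

Lemma imset_setD1 (s : {set T}) x : {in s &, injective c} -> x \in s ->
  c @: (s :\ x) = c @: s :\ c x.
Proof.
move=> inj xs; apply/setP => k; rewrite in_setD1; apply/imsetP/andP.
  case=> y; rewrite in_setD1 => /andP[yx ys] ->; split; last exact: imset_f.
  by apply: contra yx => /eqP/inj ->.
case=> kx /imsetP[y ys ky]; exists y => //; rewrite in_setD1 ys andbT.
by apply: contra kx => /eqP <-; rewrite ky.
Qed.

Lemma setU1_eq (x : T) (t s : {set T}) : x \notin t -> s = x |: t -> t = s :\ x.
Proof. by move=> xt ->; rewrite setU1K. Qed.

(** The points of a door have distinct colours, so a door of this room must omit one of the two
    points that share a colour: there are exactly two choices. *)
Lemma double_degree s C x x' : dominant s C -> x \in s -> x' \in s -> x != x' ->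
  c x = c x' -> {in s :\ x &, injective c} -> {in s :\ x' &, injective c} ->
  i0 |: c @: s = C -> i0 \notin c @: s -> ~~ odd #|doors_of (s, C)|.
Proof.
move=> dom xs x's xx' cx injx injx' sC is'.
suff -> : doors_of (s, C) = [set s :\ x; s :\ x'].
  rewrite cards2; suff -> : s :\ x != s :\ x' by [].
  by apply/eqP => /setP/(_ x); rewrite !in_setD1 eqxx xs xx'.
have imE y z : y \in s -> z \in s -> y != z -> c y = c z -> c @: (s :\ y) = c @: s.
  move=> ys zs yz cyz; apply/setP => k; apply/imsetP/imsetP => -[w].
    by rewrite in_setD1 => /andP[_ ws] ->; exists w.
  move=> ws ->; have [->|wy] := eqVneq w y; last by exists w; rewrite // in_setD1 wy.
  by exists z; rewrite // in_setD1 zs eq_sym yz.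
have half y z : y \in s -> z \in s -> y != z -> c y = c z -> {in s :\ y &, injective c} ->
    incident (s :\ y) (s, C).
  move=> ys zs yz cyz inj; rewrite /incident /door inE /= (imE y z) // is' sC dom.
  rewrite (dominantS (subD1set _ _) (subxx _) dom) /= andbT; apply/andP; split.
    by rewrite -(imE y z ys zs yz cyz); apply/imset_injP.
  by apply/orP; right; apply/exists_inP; exists y; rewrite ?inE ?eqxx // setD1K.
apply/setP => t; rewrite !inE; apply/idP/orP => [|[/eqP->|/eqP->]]; first last.
- by apply: (half x' x); rewrite 1?eq_sym.
- exact: (half x x').
case/andP=> /and3P[/rainbowP rt ict _]; rewrite inE => /andP[_] /orP[].
  case/exists_inP=> k _ /eqP[st _]; move: rt; rewrite -st => /(_ x x' xs x's cx)/eqP.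
  by rewrite (negPf xx').
case/exists_inP => y; rewrite inE => yt /eqP[sE _]; have tE := setU1_eq yt sE.
have [->|yx] := eqVneq x y; first by rewrite tE eqxx; left.
have [->|yx'] := eqVneq x' y; first by rewrite tE eqxx; right.
move: rt; rewrite tE => /(_ x x'); rewrite !in_setD1 xs x's yx yx' => /(_ isT isT cx)/eqP.
by rewrite (negPf xx').
Qed.

(** Here the colour [c x] is missing from [C]. The two doors are [s] itself, entered by freeing the
    index [c x], and [s :\ x], entered by adding [x]. *)
Lemma rainbow_degree s C x : dominant s C -> x \in s -> {in s &, injective c} ->
  i0 \notin c @: s -> C = (i0 |: c @: s) :\ c x ->
  ~~ odd #|doors_of (s, C)|.
Proof.
move=> dom xs inj is' CE.
have cxs : c x \in c @: s by exact: imset_f.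
have i0x : i0 != c x by apply: contra is' => /eqP ->.
suff -> : doors_of (s, C) = [set s; s :\ x].
  rewrite cards2; suff -> : s != s :\ x by [].
  by apply/eqP => /setP/(_ x); rewrite in_setD1 eqxx xs.
have CE' : C = i0 |: (c @: s :\ c x).
  apply/setP => k; rewrite CE !inE; case: (eqVneq k i0) => [->|_] //=; by rewrite i0x.
have rs : #|c @: s| == #|s| by apply/imset_injP.
apply/setP => t; rewrite !inE; apply/idP/orP => [|[/eqP->|/eqP->]].
- case/andP=> /and3P[_ ict _]; rewrite inE => /andP[_] /orP[].
    by case/exists_inP=> k _ /eqP[-> _]; left.
  case/exists_inP => y; rewrite inE => yt /eqP[sE CE2]; right.
  have tE := setU1_eq yt sE; have ys : y \in s by rewrite sE setU11.
  suff -> : x = y by rewrite tE.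
  apply: (inj) => //; apply/eqP; apply/negPn/negP => ne.
  have : c x \in C.
    by rewrite CE2 tE imset_setD1 // !inE ne cxs orbT.
  by rewrite CE !inE eqxx.
- rewrite /incident /door rs is' inE /= dom.
  have subC : C \subset i0 |: c @: s by rewrite CE subD1set.
  rewrite (dominantS (subxx _) subC dom) /=; apply/orP; left; apply/exists_inP.
  by exists (c x); rewrite ?CE // inE cxs orbT.
have imE : c @: (s :\ x) = c @: s :\ c x by exact: imset_setD1.
rewrite /incident /door inE /= imE -CE' dom.
rewrite (dominantS (subD1set _ _) (subxx _) dom) /= andbT; apply/andP; split.
  apply/andP; split; last by rewrite in_setD1 (negPf is') andbF.
  by rewrite -imE; apply/imset_injP => y z; rewrite !in_setD1 => /andP[_ ys] /andP[_ zs]; exact: inj.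
by apply/orP; right; apply/exists_inP; exists x; rewrite ?inE ?eqxx // setD1K.
Qed.

(** Take one door of the room. If the freed index or the colour of the added point is [i0], the room
    is colourful; otherwise it repeats one colour or is rainbow with one colour missing from [C],
    and has two doors. *)
Lemma noncolourful_degree p : ~~ colourful p -> ~~ odd #|doors_of p|.
Proof.
case: p => s C nc.
have [->|/set0Pn[t]] := eqVneq (doors_of (s, C)) set0; first by rewrite cards0.
rewrite inE => /andP[/and3P[rt ict _]]; rewrite inE => /andP[/= dom].
have inj : {in t &, injective c} by apply/rainbowP.
case/orP=> [/exists_inP[k kD /eqP[st CE]]|/exists_inP[x + /eqP[sE CE]]].
  subst t; move: kD; rewrite in_setU1 => /orP[/eqP ki|/imsetP[x xs kx]]; last first.
    by apply: (@rainbow_degree _ _ x) => //; rewrite -kx.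
  case/negP: nc; rewrite /colourful /= dom CE ki setU1K // (eqP rt) eqxx.
  by rewrite eqxx.
rewrite inE => xt; have tE := setU1_eq xt sE.
have xs : x \in s by rewrite sE setU11.
have cs : c @: s = c x |: c @: t by rewrite sE imsetU1.
have [cxi|cxi] := eqVneq (c x) i0.
  case/negP: nc; rewrite /colourful /= dom cs cxi CE eqxx andbT /=.
  by rewrite sE !cardsU1 xt ict (eqP rt).
have is' : i0 \notin c @: s by rewrite cs in_setU1 negb_or eq_sym cxi.
have [/imsetP[x' x't cxx]|cxt] := boolP (c x \in c @: t).
  have csE : c @: s = c @: t by rewrite cs cxx; apply/setUidPr; rewrite sub1set imset_f.
  have x's : x' \in s by rewrite sE setU1r.
  have xx' : x != x' by apply: contraNneq xt => ->.
  apply: (@double_degree _ _ x x') => //; rewrite ?csE -?tE //.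
  move=> y z; rewrite !in_setD1 => /andP[yx ys] /andP[zx zs] cyz.
  move: ys zs; rewrite sE !in_setU1 => /orP[/eqP yE|yt] /orP[/eqP zE|zt].
  - by rewrite yE zE.
  - by case/eqP: zx; apply: (inj) => //; rewrite -cyz yE.
  - by case/eqP: yx; apply: (inj) => //; rewrite cyz zE.
  by apply: (inj).
apply: (@rainbow_degree _ _ x) => //.
  apply/rainbowP; rewrite cs sE !cardsU1 cxt xt (eqP rt) //.
by rewrite CE cs; apply/setP => k; rewrite !inE; case: (eqVneq k (c x)) => [->|_] //=;
  rewrite (negPf cxi) (negPf cxt).
Qed.

(* Handshake argument on the incidence graph: if no room were colourful, the
   empty door would be its only vertex of odd degree. *)
Lemma exists_colourful (x1 : T) : exists s C, [/\ C != set0, dominant s C & c @: s = C].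
Proof.
have : odd (\sum_t #|rooms_of t|).
  rewrite (bigD1 set0) //= oddD; have [_ ->] := outer_door x1.
  have /negPf-> // : ~~ odd (\sum_(t | t != set0) #|rooms_of t|).
  by elim/big_ind: _ => // [m n|t /inner_door//]; rewrite oddD => /negPf-> /negPf->.
have -> : \sum_t #|rooms_of t| = \sum_p #|doors_of p|.
  under eq_bigr do rewrite -sum1_card.
  under [RHS]eq_bigr do rewrite -sum1_card.
  rewrite (exchange_big_dep predT) //=; apply: eq_bigr => p _.
  by apply: eq_bigl => t; rewrite !inE.
move=> oddS; have [[s C] cp|nc] := pickP colourful; last first.
  have : ~~ odd (\sum_p #|doors_of p|).
    elim/big_ind: _ => // [m n|p _]; first by rewrite oddD => /negPf-> /negPf->.
    by apply: noncolourful_degree; rewrite nc.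
  by rewrite oddS.
case/and3P: cp => /= dom _ /eqP cs; exists s, C; split=> //.
by have /dominantP/(_ x1)[i iC _] := dom; apply/set0Pn; exists i.
Qed.

End Scarf.

(** Scarf's lemma for the grid points of total [N], ordered by each coordinate. Dominance makes the
    coordinatewise minima over [C] almost exhaust [N], which confines the colourful room to a few
    grid steps. *)
Lemma grid_colourful (I : finType) (i1 : I) (N : nat) (c : {ffun I -> nat} -> I) :
  exists (C : {set I}) (s : I -> {ffun I -> nat}), [/\ C != set0,
    forall i, i \in C -> \sum_k s i k = N /\ c (s i) = i,
    forall i j k, i \in C -> j \in C -> s i k <= s j k + #|I| &
    forall i k, i \in C -> k \notin C -> s i k <= #|I|].
Proof.
pose T := {t : {ffun I -> 'I_N.+1} | \sum_k t k == N}.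
pose v (t : T) : {ffun I -> nat} := [ffun k => val t k : nat].
have vsum (t : T) : \sum_k v t k = N.
  by case: t => t tP; rewrite -[RHS](eqP tP); apply: eq_bigr => k _; rewrite ffunE.
have mkT (f : {ffun I -> nat}) : \sum_k f k = N -> exists t : T, v t = f.
  move=> fN; have fle k : f k < N.+1 by rewrite ltnS -fN (bigD1 k) //= leq_addr.
  pose t : {ffun I -> 'I_N.+1} := [ffun k => Ordinal (fle k)].
  have tP : \sum_k t k == N.
    by apply/eqP; rewrite -[RHS]fN; apply: eq_bigr => k _; rewrite ffunE.
  by exists (exist _ t tP); apply/ffunP => k; rewrite !ffunE.
have [t1 _] : exists t : T, v t = [ffun k => if k == i1 then N else 0].
  apply: mkT; rewrite (bigD1 i1) //= ffunE eqxx big1 ?addn0 // => k /negPf ki.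
  by rewrite ffunE ki.
(* Ties between equal coordinates are broken by the rank of the point, which makes every order
   injective. *)
pose r k (t : T) := v t k * #|{: T}| + enum_rank t.
have r_inj k : injective (r k).
  move=> t t' rt; apply/enum_rank_inj/val_inj => /=.
  have := congr1 (modn^~ #|{: T}|) rt; rewrite /r !modnMDl !modn_small //; exact: ltn_ord.
have r_le k t t' : r k t <= r k t' -> v t k <= v t' k.
  rewrite /r => h; rewrite leqNgt; apply/negP => lt.
  have := leq_mul lt (leqnn #|{: T}|); rewrite mulSn.
  have : enum_rank t' < #|{: T}| by exact: ltn_ord.
  move: h; set a := v t k * _; set b := v t' k * _; set n := #|_|.
  set e := nat_of_ord _; set e' := nat_of_ord _ => h1 h2 h3.
  have := leq_trans h3 (leq_trans (leq_addr e a) h1).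
  by rewrite addnC leq_add2l leqNgt h2.
have [S [C [C0 /dominantP dom cS]]] := exists_colourful (c \o v) r_inj i1 t1.
have [i2 i2C] := set0Pn _ C0.
have [x2 x2S _] : exists2 x, x \in S & i2 = c (v x) by apply/imsetP; rewrite cS.
pose m k := v [arg min_(x < x2 in S) v x k] k.
have mle x k : x \in S -> m k <= v x k.
  by move=> xS; rewrite /m; case: arg_minnP => // y _; apply.
(* Otherwise raising all the minima on [C] by one and putting the remaining mass on [i2] gives a
   grid point that nothing in [C] dominates. *)
have sumC : N < \sum_(k in C) m k + #|C|.
  rewrite ltnNge; apply/negP => le.
  pose f : {ffun I -> nat} := [ffun k => if k \in C then m k + 1 + (k == i2) * (N - (\sum_(k in C) m k + #|C|)) else 0].
  have [|t tf] := mkT f.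
    rewrite (bigID (mem C)) /= [X in _ + X]big1 ?addn0 => [|k /negPf kC]; last by rewrite ffunE kC.
    under eq_bigr => k kC do rewrite ffunE kC.
    rewrite !big_split /= sum1_card [X in _ + X](bigD1 i2) //= eqxx mul1n.
    rewrite [X in _ + (_ + X)]big1 => [|k /andP[_ /negPf->] //]; lia.
  have [i iC h] := dom t.
  have : v t i <= m i.
    by rewrite /m; case: arg_minnP => // x xS _; apply/r_le/h.
  by rewrite tf ffunE iC; lia.
(* A point of [S] has less than [#|C|] of mass beyond the minima, to be spent on any coordinate. *)
have bnd x : x \in S -> (forall k, k \in C -> v x k <= m k + #|I|) /\
                        (forall k, k \notin C -> v x k <= #|I|).
  move=> xS; have := vsum x; rewrite (bigID (mem C)) /= => e.
  have le1 : \sum_(k in C) m k <= \sum_(k in C) v x k by apply: leq_sum => k _; exact: mle.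
  split=> k kC; last first.
    suff /leq_trans : v x k <= #|C| by apply; exact: max_card.
    by move: sumC e; rewrite [X in _ + X = _](bigD1 k) //=; lia.
  suff /leq_trans : v x k <= m k + #|C| by apply; rewrite leq_add2l max_card.
  move: sumC e; rewrite (bigD1 k) //= [X in X + _ = _ -> _](bigD1 k) //=.
  have : \sum_(i in C | i != k) m i <= \sum_(i in C | i != k) v x i.
    by apply: leq_sum => i _; exact: mle.
  lia.
pose s i := odflt x2 [pick x in S | c (v x) == i].
have sP i : i \in C -> s i \in S /\ c (v (s i)) = i.
  rewrite -cS => /imsetP[x xS ix]; rewrite /s; case: pickP => [y /andP[yS /eqP]//|].
  by move=> /(_ x); rewrite xS ix eqxx.
exists C, (v \o s); split=> //.
- by move=> i iC; split; [exact: vsum|have [] := sP i iC].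
- move=> i j k /sP[iS _] /sP[jS _] /=; have [kC|kC] := boolP (k \in C).
    by apply: leq_trans ((bnd _ iS).1 k kC) _; rewrite leq_add2r; exact: mle.
  exact: leq_trans ((bnd _ iS).2 k kC) (leq_addl _ _).
by move=> i k /sP[iS _] kC; exact: (bnd _ iS).2.
Qed.

Require Import Defs.
From mathcomp Require Import all_order all_algebra.
From mathcomp Require Import all_classical all_reals all_analysis.
From mathcomp Require Import ring lra.
Import Order.TTheory GRing.Theory Num.Theory.
Import numFieldNormedType.Exports.
Local Open Scope classical_set_scope.
Local Open Scope ring_scope.

(** * Convex combinations *)

Lemma cvg_ge_id (f : nat -> nat) : (forall n, (n <= f n)%N) -> f @ \oo --> \oo.
Proof.
move=> fn A [N _ NA]; exists N => // n /= Nn; apply: NA => /=.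
exact: leq_trans Nn (fn n).
Qed.

Lemma increasing_seq_ge_id (f : nat -> nat) : increasing_seq f -> forall n, (n <= f n)%N.
Proof.
move=> fi; elim=> [//|n IH]; apply: leq_ltn_trans IH _.
by rewrite ltnNge; apply/negP => h; have := fi n.+1 n; rewrite !leEnat h ltnn.
Qed.

(** Coordinates are treated one at a time. Subsequences are given by maps that tend to infinity, a
    notion stable under composition. *)
Lemma bolzano_weierstrass_fin (R : realType) (I : finType) (u : nat -> I -> R) :
  (forall n i, `|u n i| <= 1) ->
  exists f : nat -> nat, f @ \oo --> \oo /\
  exists t : I -> R, forall i, (u (f n) i) @[n --> \oo] --> t i.
Proof.
move=> u1; suff H (s : seq I) : exists f : nat -> nat, f @ \oo --> \oo /\
    forall i, i \in s -> cvgn (fun n => u (f n) i).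
  have [f [fo fs]] := H (enum I); exists f; split=> //.
  exists (fun i => limn (fun n => u (f n) i)) => i.
  by apply: fs; rewrite mem_enum.
elim: s => [|i s [f [fo fs]]]; first by exists id; split=> //; exact: cvg_id.
have [|g gi gc] := @bolzano_weierstrass R (fun n => u (f n) i).
  by exists 1; split=> // x x1 n _; apply: le_trans (u1 _ _) (ltW x1).
have go : g @ \oo --> \oo by exact/cvg_ge_id/increasing_seq_ge_id.
exists (f \o g); split; first exact: cvg_comp go fo.
move=> j; rewrite in_cons => /orP[/eqP->//|/fs/cvg_ex[l fl]].
by apply/cvg_ex; exists l; apply: cvg_comp go fl.
Qed.

Definition simplex (R : realType) (I : finType) : set (I -> R) :=
  [set t | (forall i, 0 <= t i) /\ \sum_i t i = 1].

Lemma simplex_le1 (R : realType) (I : finType) (t : I -> R) i : simplex t -> 0 <= t i <= 1.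
Proof.
by move=> [t0 <-]; rewrite t0 (bigD1 i) //= lerDl sumr_ge0.
Qed.

(* A dual form of the Knaster-Kuratowski-Mazurkiewicz lemma, obtained by
   applying Scarf's lemma to finer and finer grids. *)
Lemma colour_limit (R : realType) (I : finType) (i1 : I) (P : I -> (I -> R) -> Prop) :
  (forall t, simplex t -> exists i, P i t) ->
  exists2 t : I -> R, simplex t & forall i, t i != 0 ->
    exists u : nat -> I -> R, [/\ forall n, simplex (u n), forall n, P i (u n) &
      forall k, (u n k) @[n --> \oo] --> t k].
Proof.
move=> HP.
pose sc N (f : {ffun I -> nat}) : I -> R := fun k => (f k)%:R / N.+1%:R.
have scP N (f : {ffun I -> nat}) : (\sum_k f k = N.+1)%N -> simplex (sc N f).
  move=> fN; split=> [i|]; first by rewrite divr_ge0.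
  by rewrite -mulr_suml -natr_sum fN divff.
have [c cP] : exists c : nat -> {ffun I -> nat} -> I,
    forall N f, simplex (sc N f) -> P (c N f) (sc N f).
  have /choice[c cP] : forall p : nat * {ffun I -> nat}, exists i,
      simplex (sc p.1 p.2) -> P i (sc p.1 p.2).
    move=> p; have [/HP[i Pi]|ns] := pselect (simplex (sc p.1 p.2)); first by exists i.
    (* Off the simplex the colour is the arbitrary default [i1]. *)
    by exists i1 => /ns.
  by exists (fun N f => c (N, f)) => N f; exact: cP (N, f).
have /choice[G GP] : forall N, exists p : {set I} * (I -> {ffun I -> nat}) * I,
   [/\ p.2 \in p.1.1,
    forall i, i \in p.1.1 -> (\sum_k p.1.2 i k = N.+1)%N /\ c N (p.1.2 i) = i,
    forall i j k, i \in p.1.1 -> j \in p.1.1 -> (p.1.2 i k <= p.1.2 j k + #|I|)%N &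
    forall i k, i \in p.1.1 -> k \notin p.1.1 -> (p.1.2 i k <= #|I|)%N].
  move=> N; have [C [s [/set0Pn[i iC] h1 h2 h3]]] := grid_colourful i1 N.+1 (c N).
  by exists ((C, s), i).
pose C N := (G N).1.1; pose s N := (G N).1.2; pose j N := (G N).2.
pose x N := sc N (s N (j N)).
have x_simplex N : simplex (x N).
  by have [jC h _ _] := GP N; apply: scP; have [] := h _ jC.
have [|f [fo [t xt]]] := @bolzano_weierstrass_fin R I x.
  by move=> n i; have /andP[x0 x1] := simplex_le1 i (x_simplex n); rewrite ger0_norm.
have inv0 : (#|I|%:R / (f n).+1%:R : R) @[n --> \oo] --> (0 : R).
  have h : (f n).+1%:R^-1 @[n --> \oo] --> (0 : R) by exact: cvg_comp fo (@cvg_harmonic R).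
  by rewrite -(mulr0 #|I|%:R); apply: cvgM => //; exact: cvg_cst.
have t_simplex : simplex t.
  split=> [i|].
    apply: cvgr_to_ge (xt i) _; apply: nearW => n.
    by have [x0 _] := x_simplex (f n).
  have : (\sum_i x (f n) i) @[n --> \oo] --> \sum_i t i by apply: cvg_big => //; exact: add_continuous.
  under eq_fun do rewrite (x_simplex _).2.
  by move=> /cvg_lim <- //; rewrite lim_cst.
exists t => // i ti0.
have ti : 0 < t i by rewrite lt_neqAle eq_sym ti0; exact: t_simplex.1.
(* A coordinate outside [C] is at most [#|I|] grid steps, which tends to 0, whereas coordinate [i]
   tends to [t i > 0]. *)
have [n0 _ Hn0] : \forall n \near \oo, i \in C (f n).
  have h1 : \forall n \near \oo, t i / 2 < x (f n) i.
    by apply: (cvgr_gt _ (xt i)); lra.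
  have h2 : \forall n \near \oo, #|I|%:R / (f n).+1%:R < t i / 2.
    by apply: (cvgr_lt _ inv0); lra.
  near=> n; have [jC _ _ h] := GP (f n); apply/negPn/negP => iC.
  have lt1 : t i / 2 < x (f n) i by near: n.
  have lt2 : #|I|%:R / (f n).+1%:R < t i / 2 by near: n.
  have := lt_trans lt2 lt1; rewrite /x /sc ltr_pM2r ?invr_gt0 // ltr_nat ltnNge.
  by rewrite h.
pose g n := f (n + n0)%N.
have gC n : i \in C (g n) by apply: Hn0; exact: leq_addl.
exists (fun n => sc (g n) (s (g n) i)); split=> [n|n|k].
- by have [_ h _ _] := GP (g n); apply: scP; have [] := h _ (gC n).
- have [_ /(_ _ (gC n))[h1 h2] _ _] := GP (g n).
  by rewrite -{1}h2; apply: cP; apply: scP.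
have addo : (fun n => n + n0)%N @ \oo --> \oo by exact: cvg_addnr.
have xk := cvg_comp _ _ addo (xt k); have ik := cvg_comp _ _ addo inv0.
(* The point coloured [i] is within [#|I|] grid steps of the reference point [x], so both have the
   same limit. *)
apply: (@squeeze_cvgr _ _ _ _ (fun n => x (g n) k - #|I|%:R / (g n).+1%:R)
         (fun n => x (g n) k + #|I|%:R / (g n).+1%:R)).
- near=> n; have [jC _ h _] := GP (g n); apply/andP; split.
    rewrite lerBlDr /x /sc -mulrDl ler_pM2r ?invr_gt0 // -natrD ler_nat.
    exact: h jC (gC n).
  rewrite /x /sc -mulrDl ler_pM2r ?invr_gt0 // -natrD ler_nat.
  exact: h (gC n) jC.
- by rewrite -[t k]subr0; apply: cvgB.
- by rewrite -[t k]addr0; apply: cvgD.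
Unshelve. all: by end_near. Qed.

(** Induction over the list of indices, with partial sums renormalised to total weight 1. Positivity
    of the weight in the inductive claim disposes of empty and zero-weight lists. *)
Lemma Wconvex_sum (R : realType) (E : normedModType R) (A : set E) (I : finType)
  (t : I -> R) (y : I -> E) : Wconvex A -> simplex t ->
  (forall i, t i != 0 -> A (y i)) -> A (\sum_i t i *: y i).
Proof.
move=> cA [t0 t1] Ay.
suff H (s : seq I) : 0 < \sum_(i <- s) t i ->
    A ((\sum_(i <- s) t i)^-1 *: \sum_(i <- s) t i *: y i).
  by have := H (index_enum I); rewrite t1 invr1 scale1r; apply.
elim: s => [|i s IH]; first by rewrite big_nil ltxx.
rewrite !big_cons; set S := \sum_(_ <- s) t _; set Y := \sum_(_ <- s) _.
have S0 : 0 <= S by rewrite /S sumr_ge0.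
have [->|ti0] := eqVneq (t i) 0; first by rewrite add0r scale0r add0r; exact: IH.
have ti : 0 < t i by rewrite lt_neqAle eq_sym ti0 t0.
move: S0; rewrite le_eqVlt => /orP[/eqP S0|Sp].
  have -> : Y = 0.
    rewrite /Y big_seq big1 // => k ks; suff -> : t k = 0 by rewrite scale0r.
    apply/eqP; rewrite eq_le t0 andbT [leRHS]S0 /S (big_rem k) //= lerDl sumr_ge0 //.
  by rewrite -S0 !addr0 scalerA mulVf // scale1r => _; exact: Ay.
move=> tS.
have -> : (t i + S)^-1 *: (t i *: y i + Y) =
    (t i / (t i + S)) *: y i + (1 - t i / (t i + S)) *: (S^-1 *: Y).
  rewrite scalerDr !scalerA; congr (_ *: _ + _ *: _); first by rewrite mulrC.
  by field; rewrite !gt_eqF.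
apply: cA; [exact: Ay|exact: IH|].
apply/andP; split; first by rewrite divr_ge0 // ltW.
by rewrite ler_pdivrMr // mul1r lerDl ltW.
Qed.

(** * Functionals separate points *)

Section Sublinear.
Variables (R : realType) (E : lmodType R).
Implicit Types (p q : E -> R) (x y z : E).

Definition sublinear q :=
  (forall x y, q (x + y) <= q x + q y) /\ (forall t x, 0 < t -> q (t *: x) <= t * q x).

Lemma sublinear0 q : sublinear q -> q 0 = 0.
Proof.
move=> [_ qZ]; have := qZ 2 0 ltac:(lra); have := qZ (2^-1) 0 ltac:(lra).
rewrite !scaler0; lra.
Qed.

Lemma sublinearZ q t x : sublinear q -> 0 <= t -> q (t *: x) = t * q x.
Proof.
move=> sq; rewrite le_eqVlt => /orP[/eqP<-|t0].
  by rewrite scale0r mul0r sublinear0.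
apply/eqP; rewrite eq_le; case: sq => _ qZ; rewrite qZ //=.
have := qZ t^-1 (t *: x); rewrite invr_gt0 => /(_ t0).
by rewrite scalerA mulVf ?gt_eqF // scale1r ler_pdivlMl.
Qed.

Lemma sublinearN q x : sublinear q -> - q (- x) <= q x.
Proof.
by move=> sq; have := sq.1 x (- x); rewrite subrr sublinear0 //; lra.
Qed.

(** For sublinear [q] this functional lies below [q] (take [t = 0]) and is at most [- q y] at [- y]
    (take [t = 1]), which pins down linearity in the direction [y]. *)
Definition along q y x := inf [set q (x + t *: y) - t * q y | t in [set t | 0 <= t]].

Lemma along_le q y x t : sublinear q -> 0 <= t -> along q y x <= q (x + t *: y) - t * q y.
Proof.
move=> sq t0; apply: ge_inf; last by exists t.
exists (- q (- x)) => _ [s /= s0 <-].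
have := sq.1 (x + s *: y) (- x); rewrite addrAC subrr add0r sublinearZ //; lra.
Qed.

Lemma along_ge q y x b :
  (forall t, 0 <= t -> b <= q (x + t *: y) - t * q y) -> b <= along q y x.
Proof.
move=> H; apply: lb_le_inf; first by exists (q (x + 0 *: y) - 0 * q y); exists 0 => //=.
by move=> _ [t /= t0 <-]; exact: H.
Qed.

Lemma along_sublinear q y : sublinear q -> sublinear (along q y).
Proof.
move=> sq; split=> [x x'|r x r0].
  rewrite -lerBlDr; apply: along_ge => t t0; rewrite lerBlDr -lerBlDl.
  apply: along_ge => s s0.
  have := along_le y (x + x') sq (addr_ge0 s0 t0).
  have := sq.1 (x + t *: y) (x' + s *: y).
  rewrite [x + t *: y + _]addrACA -scalerDl [t + s]addrC; lra.
rewrite -ler_pdivrMl //; apply: along_ge => t t0; rewrite ler_pdivrMl //.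
have := along_le y (r *: x) sq (mulr_ge0 (ltW r0) t0).
by rewrite -scalerA -scalerDr (sublinearZ _ sq (ltW r0)) mulrBr mulrA.
Qed.

(** Zorn's lemma for the reversed pointwise order. The infimum of a chain is finite, being bounded
    below by [- p (- x)], and it is subadditive because any two members of the chain are
    comparable. *)
Lemma minimal_sublinear p : sublinear p -> exists q, [/\ sublinear q,
  forall x, q x <= p x &
  forall q', sublinear q' -> (forall x, q' x <= q x) -> forall x, q x <= q' x].
Proof.
move=> sp; pose T := {q | sublinear q /\ forall x, q x <= p x}.
pose r (a b : T) := `[< forall x, sval b x <= sval a x >].
have [||A Atot|[q [sq qp]] qmin] := @ZL_preorder T (exist _ p (conj sp (fun x => lexx _))) r.
- by move=> a; apply/asboolP.
- by move=> a b c /asboolP ba /asboolP cb; apply/asboolP => x; exact: le_trans (cb x) (ba x).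
- have [[a0 Aa0]|A0] := pselect (A !=set0); last first.
    by exists (exist _ p (conj sp (fun x => lexx _))) => a Aa; case: A0; exists a.
  pose m x := inf [set sval a x | a in A].
  have m_le a x : A a -> m x <= sval a x.
    move=> Aa; apply: ge_inf; last by exists a.
    exists (- p (- x)) => _ [b _ <-]; case: b => b [sb bp] /=.
    by apply: le_trans (sublinearN _ sb); rewrite lerN2.
  have m_ge x b : (forall a, A a -> b <= sval a x) -> b <= m x.
    by move=> H; apply: lb_le_inf; [exists (sval a0 x), a0|move=> _ [a Aa <-]; exact: H].
  have sm : sublinear m.
    split=> [x y|t x t0].
      rewrite -lerBlDr; apply: (m_ge) => a Aa; rewrite lerBlDr -lerBlDl.
      apply: (m_ge) => b Ab; rewrite lerBlDl.
      have [[sa _] [sb _]] := (svalP a, svalP b).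
      have [/asboolP ab|/asboolP ba] := Atot a b Aa Ab.
        have := m_le b (x + y) Ab; have := sb.1 x y; have := ab x; lra.
      have := m_le a (x + y) Aa; have := sa.1 x y; have := ba y; lra.
    rewrite -ler_pdivrMl //; apply: (m_ge) => a Aa; rewrite ler_pdivrMl //.
    by apply: le_trans (m_le a _ Aa) _; have [[_ h] _] := svalP a; exact: h.
  have mp x : m x <= p x by apply: le_trans (m_le a0 x Aa0) _; have [_] := svalP a0.
  by exists (exist _ m (conj sm mp)) => a Aa; apply/asboolP => x; exact: m_le.
exists q; split=> // q' sq' q'q.
have q'p x : q' x <= p x by exact: le_trans (qp x).
have /asboolP := qmin (exist _ q' (conj sq' q'p)) ltac:(exact/asboolP).
exact.
Qed.

(* A minimal sublinear functional [q] equals its regularisation [along q y],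
   which makes it additive. *)
Lemma sublinear_extension p : sublinear p -> exists f : E -> R,
  (forall a x y, f (a *: x + y) = a * f x + f y) /\ (forall x, f x <= p x).
Proof.
move=> sp; have [q [sq qp qmin]] := minimal_sublinear sp.
have qD x y : q (x + y) = q x + q y.
  apply/eqP; rewrite eq_le sq.1 /=.
  have := qmin _ (along_sublinear y sq) _ x; have := along_le y x sq ler01.
  rewrite scale1r mul1r => h1 h2.
  suff : q x <= along q y x by lra.
  apply: (h2) => z; have := along_le y z sq (lexx 0).
  by rewrite scale0r addr0 mul0r subr0.
have qN x : q (- x) = - q x.
  by have := qD x (- x); rewrite subrr sublinear0 // => /eqP; rewrite eq_sym addrC addr_eq0 => /eqP.
exists q; split=> // a x y; rewrite qD; congr (_ + _).
have [a0|a0] := leP 0 a; first by rewrite sublinearZ.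
have := @sublinearZ q (- a) x sq; rewrite oppr_ge0 => /(_ (ltW a0)).
by rewrite scaleNr qN mulNr => /oppr_inj.
Qed.

End Sublinear.

(** Extend from [along] of the norm in the direction [x - y]: being below the norm makes the
    functional continuous, and its value at [- (x - y)] is at most minus the norm of [x - y]. *)
Lemma Wdual_separates (R : realType) (E : normedModType R) (x y : E) :
  (forall f, Wdual_fun f -> f x = f y) -> x = y.
Proof.
move=> H; apply/eqP; rewrite -subr_eq0; apply/negPn/negP => z0.
have sn : sublinear (fun x : E => `|x|).
  by split=> [u v|t u t0]; [exact: ler_normD|rewrite normrZ gtr0_norm].
have [f [flin fp]] := sublinear_extension (along_sublinear (x - y) sn).
have fn u : f u <= `|u|.
  apply: le_trans (fp u) _; have := along_le (x - y) u sn (lexx 0).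
  by rewrite scale0r addr0 mul0r subr0.
have fB u v : f (u - v) = f u - f v.
  by have := flin (-1) v u; rewrite scaleN1r mulN1r addrC => ->; rewrite addrC.
have fN u : f (- u) = - f u.
  by have := fB 0 u; have := fB u u; rewrite !sub0r subrr subrr => -> ->; rewrite sub0r.
have cf : continuous f.
  move=> u; apply/cvgrPdist_lt => e e0; near=> v.
  have uv : `|u - v| < e by near: v; apply: cvgr_dist_lt.
  rewrite -fB; apply: le_lt_trans uv; rewrite ler_norml fn andbT lerNl -fN.
  by apply: le_trans (fn _) _; rewrite normrN.
have fxy := H f (conj flin cf).
have := along_le (x - y) (- (x - y)) sn ler01; have := fp (- (x - y)).
rewrite scale1r addNr normr0 mul1r sub0r fN fB fxy subrr oppr0 => h1 h2.
have := le_trans h1 h2; rewrite oppr_ge0 normr_le0; exact/negP.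
Unshelve. all: by end_near. Qed.

(** * The weak topology *)

Section WeakTopology.
Variables (R : realType) (E : normedModType R).
Implicit Types (A C O U : set E) (f : E -> R) (u : nat -> E) (x y : E).

Lemma Wdual_linear f a x y : Wdual_fun f -> f (a *: x + y) = a * f x + f y.
Proof. by case. Qed.

Lemma WdualB f x y : Wdual_fun f -> f (x - y) = f x - f y.
Proof.
by move=> df; rewrite addrC -scaleN1r (Wdual_linear _ _ _ df) mulN1r addrC.
Qed.

Lemma Wdual0 f : Wdual_fun f -> f 0 = 0.
Proof. by move=> df; rewrite -(subrr 0) WdualB // subrr. Qed.

Lemma WdualZ f a x : Wdual_fun f -> f (a *: x) = a * f x.
Proof. by move=> df; have := Wdual_linear a x 0 df; rewrite Wdual0 // !addr0. Qed.

Lemma WdualD f x y : Wdual_fun f -> f (x + y) = f x + f y.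
Proof. by move=> df; have := Wdual_linear 1 x y df; rewrite scale1r mul1r. Qed.

Lemma Wdual_sum f (I : finType) (t : I -> R) (y : I -> E) : Wdual_fun f ->
  f (\sum_i t i *: y i) = \sum_i t i * f (y i).
Proof.
move=> df; elim: (index_enum I) => [|i s IH]; first by rewrite !big_nil Wdual0.
by rewrite !big_cons WdualD // WdualZ // IH.
Qed.

Lemma Wwopen_setT : Wwopen [set: E].
Proof.
by move=> x _; exists 0%N, (fun _ _ => 0), 1; split=> // _; split=> [*|y]; [lra|exact: cvg_cst].
Qed.

Lemma Wwopen_setI A C : Wwopen A -> Wwopen C -> Wwopen (A `&` C).
Proof.
move=> oA oC x [/oA[n [fs [e [dfs e0 fsA]]]] /oC[m [gs [d [dgs d0 gsC]]]]].
exists (n + m)%N, (fun i => if (i < n)%N then fs i else gs (i - n)%N), (Num.min e d); split.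
- by move=> i; case: ifP.
- by rewrite lt_min e0.
move=> y H; split.
  apply: fsA => i ni; have := H i; rewrite ni lt_min => /(_ (ltn_addr _ ni)).
  by move=> /andP[].
apply: gsC => i mi; have := H (n + i)%N; rewrite ltn_add2l => /(_ mi).
by rewrite ltnNge leq_addr /= addKn lt_min => /andP[].
Qed.

Lemma Wwopen_bigcup (I : Type) (G : I -> set E) :
  (forall i, Wwopen (G i)) -> Wwopen (\bigcup_i G i).
Proof.
move=> oG x [i _ /oG[n [fs [e [dfs e0 fsG]]]]]; exists n, fs, e; split=> // y /fsG.
by exists i.
Qed.

Lemma Wwopen_preimage f (O : set R) : Wdual_fun f -> open O -> Wwopen (f @^-1` O).
Proof.
move=> df oO x Ox; have /nbhs_ballP[e e0 eO] : nbhs (f x) O by exact: open_nbhs_nbhs.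
exists 1%N, (fun=> f), e; split=> // y /(_ 0%N isT) h.
by apply: eO; rewrite /ball /= distrC.
Qed.

Lemma Wwopen_Wwball x n (fs : nat -> E -> R) e : (forall i, Wdual_fun (fs i)) ->
  Wwopen (Wwball x n fs e).
Proof.
move=> dfs; elim: n => [|n IH]; first by move=> y _; exists 0%N, fs, 1; split.
have -> : Wwball x n.+1 fs e = Wwball x n fs e `&` fs n @^-1` (ball (fs n x) e).
  apply/seteqP; split=> y.
    by move=> H; split=> [i ni|]; [apply/H/ltnW|rewrite /= /ball /= distrC; exact: H].
  move=> [H1 H2] i; rewrite ltnS leq_eqVlt => /orP[/eqP->|/H1//].
  by move: H2; rewrite /= /ball /= distrC.
by apply: Wwopen_setI => //; apply: Wwopen_preimage => //; exact: ball_open.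
Qed.

Lemma Wwball_center x n (fs : nat -> E -> R) e : 0 < e -> Wwball x n fs e x.
Proof. by move=> e0 i _; rewrite subrr normr0. Qed.

Lemma Wwcvg_near u x O : Wwcvg u x -> Wwopen O -> O x -> \forall k \near \oo, O (u k).
Proof.
move=> ux oO /oO[n [fs [e [dfs e0 fsO]]]].
suff : \forall k \near \oo, forall i, (i < n)%N -> `|fs i (u k) - fs i x| < e.
  by apply: filterS => k; exact: fsO.
elim: n {fsO} => [|n IH]; first by apply: nearW.
have /cvgrPdistC_lt/(_ _ e0) h := ux _ (dfs n); near=> k => i; rewrite ltnS leq_eqVlt.
case/orP => [/eqP->|]; first by near: k.
by move: i; near: k.
Unshelve. all: by end_near. Qed.

Lemma Wwcvg_comp u x (g : nat -> nat) : g @ \oo --> \oo -> Wwcvg u x -> Wwcvg (u \o g) x.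
Proof. by move=> go ux f df; apply: cvg_comp go (ux f df). Qed.

Lemma subset_Wwclosure A : A `<=` Wwclosure A.
Proof. by move=> x Ax n fs e dfs e0; exists x; split=> //; exact: Wwball_center. Qed.

Lemma Wwclosure_closed A : Wwclosed (Wwclosure A).
Proof.
move=> x /existsNP[n /existsNP[fs /existsNP[e]]] /not_implyP[dfs] /not_implyP[e0 nA].
have [m [gs [d [dgs d0 gsO]]]] := Wwopen_Wwball dfs (@Wwball_center x n fs e e0).
exists m, gs, d; split=> // y /gsO yb /= yA.
have [k [hs [c [dhs c0 hsO]]]] := Wwopen_Wwball dfs yb.
by have [z [/hsO zb Az]] := yA k hs c dhs c0; apply: nA; exists z.
Qed.

Lemma Wwclosure_min A C : Wwclosed C -> A `<=` C -> Wwclosure A `<=` C.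
Proof.
move=> cC AC x xA; apply: contrapT => /cC[n [fs [e [dfs e0 fsC]]]].
by have [y [/fsC]] := xA n fs e dfs e0; move=> nC /AC.
Qed.

Lemma Wwclosed_cvg C u x : Wwclosed C -> Wwcvg u x -> (\forall k \near \oo, C (u k)) -> C x.
Proof.
move=> cC ux Cu; apply: contrapT => nCx.
have [[n _ nC] [m _ mC]] := (Cu, Wwcvg_near ux cC nCx).
by apply: (mC (maxn n m)); [exact: leq_maxr|apply: nC; exact: leq_maxl].
Qed.

(** Compactness as an induction principle: a hereditary property stable under finite unions holds on
    [K] once it holds locally. Later proofs use it in place of finite subcovers. *)
Lemma Wwcompact_ind (K : set E) (Q : set E -> Prop) : Wwcompact K -> Q set0 ->
  (forall A C, Q A -> Q C -> Q (A `|` C)) -> (forall A C, A `<=` C -> Q C -> Q A) ->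
  (forall x, K x -> exists O, [/\ Wwopen O, O x & Q O]) -> Q K.
Proof.
move=> cK Q0 QU QS H.
pose T := {O : set E | Wwopen O /\ Q O}.
have [||s sK] := cK T sval; first by move=> [V []].
  by move=> x /H[V [oO Ox QO]]; exists (exist _ V (conj oO QO)).
apply: (QS _ _ sK); elim: s {sK} => [|[V [oO QO]] s IH].
  by apply: (QS) Q0 => x [i []].
apply: (QS) (QU _ _ QO IH) => x [i [<-|si] ix]; [by left|right].
by exists i.
Qed.

(** Without a cluster point every point of [K] has a neighbourhood that [u] eventually avoids, so
    [u] would eventually avoid [K]. *)
Lemma Wwcompact_cluster (K : set E) u : Wwcompact K -> (forall n, K (u n)) ->
  exists2 x, K x & forall O, Wwopen O -> O x -> forall n, exists2 m, (n <= m)%N & O (u m).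
Proof.
move=> cK Ku; apply: contrapT => nx.
have [] : exists n, forall m, (n <= m)%N -> ~ K (u m); last by move=> n /(_ n (leqnn _)).
apply: (Wwcompact_ind (Q := fun A => exists n, forall m, (n <= m)%N -> ~ A (u m)) cK).
- by exists 0%N => m _ [].
- move=> A C [n nA] [m mC]; exists (maxn n m) => k; rewrite geq_max => /andP[nk mk].
  by case; [exact: nA|exact: mC].
- by move=> A C AC [n nC]; exists n => m /nC h /AC.
move=> x Kx; apply: contrapT => nO; apply: nx; exists x => // O oO Ox n.
apply: contrapT => nm; apply: nO; exists O; split=> //.
by exists n => m nm' Om; apply: nm; exists m.
Qed.

End WeakTopology.

(** An alias that carries the weak topology, kept apart from the norm topology of [E], so that the
    general theory of normal spaces applies. *)
Definition weak_space (R : realType) (E : normedModType R) : Type := E.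

HB.instance Definition _ (R : realType) (E : normedModType R) := Choice.on (weak_space E).
HB.instance Definition _ (R : realType) (E : normedModType R) :=
  isOpenTopological.Build (weak_space E) (@Wwopen_setT R E) (@Wwopen_setI R E)
    (@Wwopen_bigcup R E).

(** Urysohn's lemma in [weak_space E]. Continuity is stated along weakly convergent sequences, to
    match sequential upper semicontinuity. *)
Lemma weak_urysohn (R : realType) (E : normedModType R) (A C : set E) : Wweakly_normal E -> Wwclosed A -> Wwclosed C -> A `&` C = set0 ->
  exists th : E -> R, [/\ forall x, 0 <= th x <= 1, forall x, A x -> th x = 0,
    forall x, C x -> th x = 1 & forall (u : nat -> E) x, Wwcvg u x -> th (u n) @[n --> \oo] --> th x].
Proof.
move=> nE cA cC AC0.
have ncl (B : set E) : @closed (weak_space E) B -> Wwclosed B.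
  by rewrite -openC.
have nW : normal_space (weak_space E).
  apply/(@normal_openP R) => B D cB cD; exact: nE (ncl _ cB) (ncl _ cD).
have clE (B : set E) : Wwclosed B -> @closed (weak_space E) B.
  by rewrite -openC.
have sAC : @uniform_separator (weak_space E) A C.
  by apply: ((@normal_separatorP R _).1 nW) => //; exact: clE.
have [f [cf f01 f0 f1]] := (@uniform_separatorP (weak_space E) R A C).1 sAC.
exists f; split.
- by move=> x; have := f01 (f x); rewrite /= in_itv /=; apply; exists x.
- by move=> x Ax; apply: f0; exists x.
- by move=> x Cx; apply: f1; exists x.
move=> u x ux O /cf /= ; rewrite nbhsE => -[B [oB Bx] BO].
by have := Wwcvg_near ux oB Bx; apply: filterS => k; exact: BO.
Qed.


(** * Weak compactness and sequences under a countable separating family *)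

Section Separable.
Variables (R : realType) (E : normedModType R) (d : nat -> E -> R).
Hypothesis d_dual : forall k, Wdual_fun (d k).
Hypothesis d_sep : forall x y : E, (forall k, d k x = d k y) -> x = y.

Lemma Wwball_cvg (u : nat -> E) x : (forall n, Wwball x n d n.+1%:R^-1 (u n)) ->
  forall k, d k (u n) @[n --> \oo] --> d k x.
Proof.
move=> ub k; apply/cvgrPdistC_lt => e e0.
have := near_infty_natSinv_lt (PosNum e0) => /= ne.
near=> n; apply: lt_trans (ub n k _) _; first by near: n; exact: nbhs_infty_gt.
by near: n.
Unshelve. all: by end_near. Qed.

(** Some [d k] separates any [y != x] of [K] from [x], so [u] eventually leaves a neighbourhood of
    [y]; near [x] the values of [f] are close to [f x]. Compactness joins these local statements. *)
Lemma Wwcompact_cvg (K : set E) (u : nat -> E) x : Wwcompact K -> (forall n, K (u n)) ->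
  (forall k, d k (u n) @[n --> \oo] --> d k x) -> Wwcvg u x.
Proof.
move=> cK Ku ux f df; apply/cvgrPdistC_lt => e e0.
suff : \forall n \near \oo, K (u n) -> `|f (u n) - f x| < e.
  by apply: filterS => n; apply.
apply: (Wwcompact_ind cK (Q := fun A => \forall n \near \oo, A (u n) -> `|f (u n) - f x| < e)).
- exact: nearW.
- by move=> A C QA QC; near=> n; case; [near: n|near: n].
- by move=> A C AC; apply: filterS => n h /AC.
move=> y Ky; have [yx|yx] := eqVneq y x.
  exists (f @^-1` ball (f x) e); split.
  - by apply: Wwopen_preimage => //; exact: ball_open.
  - by rewrite yx; exact: ballxx.
  - by apply: nearW => n; rewrite /= /ball /= distrC.
have /existsNP[k dk] : ~ forall k, d k y = d k x by move=> /d_sep /eqP; exact/negP.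
pose c := `|d k y - d k x|; have c0 : 0 < c by rewrite normr_gt0 subr_eq0; apply/eqP.
exists (d k @^-1` ball (d k y) (c / 2)); split.
- by apply: Wwopen_preimage => //; exact: ball_open.
- by apply: ballxx; rewrite divr_gt0.
have : \forall n \near \oo, `|d k (u n) - d k x| < c / 2.
  by have /cvgrPdistC_lt := ux k; apply; rewrite divr_gt0.
apply: filterS => n h; rewrite /= /ball /= => h'; exfalso.
have := ler_normD (d k y - d k (u n)) (d k (u n) - d k x).
by rewrite addrA subrK -/c; lra.
Unshelve. all: by end_near. Qed.

Lemma Wwcompact_seq (K : set E) (u : nat -> E) : Wwcompact K -> (forall n, K (u n)) ->
  exists g : nat -> nat, g @ \oo --> \oo /\ exists2 x, K x & Wwcvg (u \o g) x.
Proof.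
move=> cK Ku; have [x Kx xO] := Wwcompact_cluster cK Ku.
have /choice[g gP] : forall n, exists m, (n <= m)%N /\ Wwball x n d n.+1%:R^-1 (u m).
  move=> n; have [||m nm um] := xO (Wwball x n d n.+1%:R^-1) _ _ n; last by exists m.
    exact: Wwopen_Wwball.
  exact: Wwball_center.
exists g; split; first by apply: cvg_ge_id => n; have [] := gP n.
exists x => //; apply: (Wwcompact_cvg cK) => [n|]; first exact: Ku.
by apply: Wwball_cvg => n; have [] := gP n.
Qed.

(** Choose points of [A] in balls given by ever more of the [d k] and ever smaller radii;
    compactness upgrades convergence against the [d k] to weak convergence. *)
Lemma Wwclosure_seq (A : set E) x : Wwcompact (Wwclosure A) -> Wwclosure A x ->
  exists u : nat -> E, (forall n, A (u n)) /\ Wwcvg u x.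
Proof.
move=> cA Ax.
have /choice[u uP] : forall n : nat, exists y : E, Wwball x n d n.+1%:R^-1 y /\ A y.
  by move=> n; exact: Ax.
exists u; split=> [n|]; first by have [] := uP n.
apply: (Wwcompact_cvg cA) => [n|]; first by apply: subset_Wwclosure; have [] := uP n.
by apply: Wwball_cvg => n; have [] := uP n.
Qed.

End Separable.

(** * Sequentially upper semicontinuous multimaps *)

Lemma near_forall_ltn (n : nat) (P : nat -> nat -> Prop) :
  (forall i, (i < n)%N -> \forall k \near \oo, P i k) ->
  \forall k \near \oo, forall i, (i < n)%N -> P i k.
Proof.
elim: n => [|n IH] H; first exact: nearW.
have h1 := IH (fun i ni => H i (ltnW ni)); have h2 := H n (leqnn _).
near=> k => i; rewrite ltnS leq_eqVlt => /orP[/eqP->|]; first by near: k.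
by move: i; near: k.
Unshelve. all: by end_near. Qed.

Lemma closed_affine_band (R : realType) (a s c e : R) :
  closed [set r | `|a + s * r - c| <= e].
Proof.
have -> : [set r | `|a + s * r - c| <= e] =
  (fun r => `|a + s * r - c|) @^-1` [set y | y <= e] by [].
apply: closed_comp; last exact: closed_le.
move=> r _; apply: cvg_norm; apply: cvgB; last exact: cvg_cst.
by apply: cvgD; [exact: cvg_cst|apply: cvgM; [exact: cvg_cst|exact: cvg_id]].
Qed.

Lemma Wwclosed_bands (R : realType) (E : normedModType R) n (hs : nat -> E -> R)
  (K : nat -> set R) : (forall i, Wdual_fun (hs i)) -> (forall i, closed (K i)) ->
  Wwclosed [set w | forall i, (i < n)%N -> K i (hs i w)].
Proof.
move=> dhs cK w /existsNP[i] /not_implyP[ni nK].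
have oKi : open (~` K i) by rewrite openC.
have [m [fs [e [dfs e0 fsK]]]] := Wwopen_preimage (dhs i) oKi nK.
by exists m, fs, e; split=> // y /fsK /= h1 h2; apply: h1; exact: h2.
Qed.

Lemma Wwcompact_bounded (R : realType) (E : normedModType R) (K : set E) (f : E -> R) :
  Wwcompact K -> Wdual_fun f -> exists B : R, forall y, K y -> `|f y| <= B.
Proof.
move=> cK df; apply: (Wwcompact_ind (Q := fun A => exists B : R, forall y, A y -> `|f y| <= B) cK).
- by exists 0.
- move=> A C [a Aa] [b Cb]; exists (Num.max a b) => y [/Aa|/Cb] h; rewrite le_max h ?orbT //.
- by move=> A C AC [b Cb]; exists b => y /AC/Cb.
move=> x _; exists (f @^-1` ball (f x) 1); split.
- by apply: Wwopen_preimage => //; exact: ball_open.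
- exact: ballxx.
exists (`|f x| + 1) => y; rewrite /= /ball /= => h.
have := ler_distD (f x) (f y) 0; rewrite !subr0 distrC; lra.
Qed.

Section Multimap.
Variables (R : realType) (E : normedModType R) (d : nat -> E -> R).
Hypothesis d_dual : forall k, Wdual_fun (d k).
Hypothesis d_sep : forall x y : E, (forall k, d k x = d k y) -> x = y.
Variables (D : set E) (F : E -> set E).
Hypothesis hF : Wseq_usc D F.
Hypothesis hwc : forall x, D x -> Wwcompact (F x).

Lemma usc_freq (C : set E) (u : nat -> E) x : Wwclosed C -> (forall k, D (u k)) -> D x ->
  Wwcvg u x -> (forall n, exists2 m, (n <= m)%N & F (u m) `&` C !=set0) ->
  F x `&` C !=set0.
Proof.
move=> cC Du Dx ux H.
have /choice[g gP] : forall n, exists m, (n <= m)%N /\ F (u m) `&` C !=set0.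
  by move=> n; have [m] := H n; exists m.
apply: (hF cC (u := u \o g)) => // [k|k|]; first exact: Du.
  by have [] := gP k.
by apply: Wwcvg_comp => //; apply: cvg_ge_id => n; have [] := gP n.
Qed.

(** If [f] exceeded [B + 1] in modulus infinitely often, semicontinuity would yield such a value in
    [F x], where [B] bounds it. *)
Lemma usc_bounded (u w : nat -> E) x f : (forall k, D (u k)) -> D x -> Wwcvg u x ->
  (forall k, F (u k) (w k)) -> Wdual_fun f ->
  exists B : R, \forall k \near \oo, `|f (w k)| <= B.
Proof.
move=> Du Dx ux Fw df; have [B FB] := Wwcompact_bounded (hwc Dx) df.
exists (B + 1); apply: contrapT => nB.
pose C := [set y | forall i, (i < 1)%N -> [set r : R | B + 1 <= `|r|] (f y)].
have cC : Wwclosed C.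
  apply: (Wwclosed_bands (hs := fun=> f) (K := fun=> [set r : R | B + 1 <= `|r|])) => // _.
  have -> : [set r : R | B + 1 <= `|r|] = (fun r => `|r|) @^-1` [set y | B + 1 <= y] by [].
  by apply: closed_comp; [move=> r _; exact: norm_continuous|exact: closed_ge].
have [|y [Fy /(_ 0%N isT) /= Cy]] := usc_freq cC Du Dx ux; last by have := FB y Fy; lra.
move=> n; apply: contrapT => nm; apply: nB; exists n => // m /= nm'.
rewrite leNgt; apply/negP => lt; apply: nm; exists m => //; exists (w m); split=> // i _ /=.
exact: ltW.
Qed.

(** Semicontinuity needs a fixed closed set, so the varying weight [t k] is replaced by its limit
    [s]. The error is [t k - s] times a quantity that [usc_bounded] controls, and the margin [de]
    absorbs it. *)
Lemma usc_approx (u w : nat -> E) x x0 (t : nat -> R) (s : R) n (hs : nat -> E -> R)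
  (c : nat -> R) (e de : R) : (forall k, D (u k)) -> D x -> Wwcvg u x ->
  (forall k, F (u k) (w k)) -> t k @[k --> \oo] --> s ->
  (forall i, Wdual_fun (hs i)) -> 0 < de ->
  (\forall k \near \oo, forall i, (i < n)%N ->
     `|hs i ((1 - t k) *: x0 + t k *: w k) - c i| <= e) ->
  exists2 y, F x y & forall i, (i < n)%N ->
     `|hs i ((1 - s) *: x0 + s *: y) - c i| <= e + de.
Proof.
move=> Du Dx ux Fw ts dhs de0 H.
have hsE i a v : hs i ((1 - a) *: x0 + a *: v) = (1 - a) * hs i x0 + a * hs i v.
  by rewrite (WdualD _ _ (dhs i)) !(WdualZ _ _ (dhs i)).
pose C := [set y | forall i, (i < n)%N ->
  [set r | `|(1 - s) * hs i x0 + s * r - c i| <= e + de] (hs i y)].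
have cC : Wwclosed C.
  apply: (Wwclosed_bands (K := fun i => [set r | `|(1 - s) * hs i x0 + s * r - c i| <= e + de])) => // i.
  exact: closed_affine_band.
have [|y [Fy Cy]] := usc_freq cC Du Dx ux; last first.
  by exists y => // i ni; rewrite hsE; exact: Cy.
suff [N _ NC] : \forall k \near \oo, C (w k).
  by move=> m; exists (maxn m N); rewrite ?leq_maxl//; exists (w (maxn m N)); split=> //; apply: NC; exact: leq_maxr.
suff H2 : \forall k \near \oo, forall i, (i < n)%N -> `|t k - s| * `|hs i (w k) - hs i x0| <= de.
  near=> k => i ni /=.
  have h1 : `|hs i ((1 - t k) *: x0 + t k *: w k) - c i| <= e by move: i ni; near: k.
  have h2 : `|t k - s| * `|hs i (w k) - hs i x0| <= de by move: i ni {h1}; near: k.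
  rewrite hsE in h1; rewrite distrC -normrM in h2.
  apply: le_trans (lerD h1 h2); apply: le_trans (ler_normD _ _).
  by rewrite le_eqVlt; apply/orP; left; apply/eqP; congr (`|_|); ring.
apply: near_forall_ltn => i ni.
have [B HB] := usc_bounded Du Dx ux Fw (dhs i).
pose L : R := `|B| + `|hs i x0| + 1; have L0 : 0 < L by rewrite ltr_wpDl // addr_ge0.
have /cvgrPdistC_le/(_ (de / L)) ts' := ts.
have {}ts' := ts' (divr_gt0 de0 L0).
near=> k.
have h1 : `|hs i (w k)| <= B by near: k.
have h2 : `|t k - s| <= de / L by near: k.
rewrite -(divfK (lt0r_neq0 L0) de); apply: ler_pM => //.
apply: le_trans (ler_normB _ _) _; rewrite /L; have := ler_norm B; lra.
Unshelve. all: by end_near. Qed.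

(** If [y] were not of this form, compactness of [F x] would give one [n] for which the first [n]
    functionals keep [y] away from all candidates, against [usc_approx]. *)
Lemma usc_limit (u w : nat -> E) x x0 y (t : nat -> R) (s : R) :
  (forall k, D (u k)) -> D x -> Wwcvg u x ->
  (forall k, F (u k) (w k)) -> t k @[k --> \oo] --> s ->
  (forall i, d i ((1 - t k) *: x0 + t k *: w k) @[k --> \oo] --> d i y) ->
  exists2 v, F x v & y = (1 - s) *: x0 + s *: v.
Proof.
move=> Du Dx ux Fw ts dy; apply: contrapT => nv.
have dE i a v : d i ((1 - a) *: x0 + a *: v) = (1 - a) * d i x0 + a * d i v.
  by rewrite (WdualD _ _ (d_dual i)) !(WdualZ _ _ (d_dual i)).
(* The gap is twice [n.+1%:R^-1] because [usc_approx] is called with both tolerances equal to it. *)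
pose Q (A : set E) := exists n : nat, forall v, A v -> exists2 i, (i < n)%N &
  n.+1%:R^-1 + n.+1%:R^-1 < `|d i ((1 - s) *: x0 + s *: v) - d i y|.
have inv_le (m n : nat) : (m <= n)%N -> n.+1%:R^-1 + n.+1%:R^-1 <= m.+1%:R^-1 + m.+1%:R^-1 :> R.
  by move=> mn; apply: lerD; rewrite lef_pV2 ?posrE // ler_nat.
have [n Hn] : Q (F x).
  apply: (Wwcompact_ind (hwc Dx)).
  - by exists 0%N.
  - move=> A C [n An] [m Cm]; exists (maxn n m) => v [/An|/Cm] [i ni h]; exists i.
    + exact: leq_trans ni (leq_maxl _ _).
    + by apply: le_lt_trans h; apply: inv_le; exact: leq_maxl.
    + exact: leq_trans ni (leq_maxr _ _).
    + by apply: le_lt_trans h; apply: inv_le; exact: leq_maxr.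
  - by move=> A C AC [n Cn]; exists n => v /AC/Cn.
  move=> v Fv; have /existsNP[i di] : ~ forall i, d i ((1 - s) *: x0 + s *: v) = d i y.
    by move=> /d_sep h; apply: nv; exists v.
  pose c := `|d i ((1 - s) *: x0 + s *: v) - d i y|.
  have c0 : 0 < c by rewrite normr_gt0 subr_eq0; apply/eqP.
  have c2 : 0 < c / 2 by rewrite divr_gt0.
  have [N _ HN] := near_infty_natSinv_lt (PosNum c2).
  pose n := maxn i.+1 N.
  have nc : n.+1%:R^-1 < c / 2 by apply: HN; exact: leq_maxr.
  exists (d i @^-1` ~` [set r | `|(1 - s) * d i x0 + s * r - d i y| <= n.+1%:R^-1 + n.+1%:R^-1]); split.
  - by apply: Wwopen_preimage => //; rewrite openC; exact: closed_affine_band.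
  - by rewrite /= -dE -/c; apply/negP; rewrite -ltNge [ltRHS]splitr; apply: ltrD.
  exists n => z /= /negP; rewrite -ltNge => h; exists i; first exact: leq_maxl.
  by rewrite dE.
have n0 : 0 < n.+1%:R^-1 :> R by rewrite invr_gt0.
have [|v Fv vy] := usc_approx (x0 := x0) (n := n) (c := d^~ y) (e := n.+1%:R^-1) Du Dx ux Fw ts d_dual n0.
  by apply: near_forall_ltn => i _; have /cvgrPdistC_le := dy i; apply.
by have [i ni] := Hn v Fv; rewrite ltNge vy.
Qed.

(** An unbounded choice of values has base points with a subsequence converging in [K], where
    [usc_bounded] applies. *)
Lemma usc_bounded_image (K : set E) f : Wwcompact K -> K `<=` D -> Wdual_fun f ->
  exists B : R, forall x w, K x -> F x w -> `|f w| <= B.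
Proof.
move=> cK KD df; apply: contrapT => nB.
have /choice[p pP] : forall n : nat, exists p : E * E, [/\ K p.1, F p.1 p.2 & n%:R < `|f p.2|].
  move=> n; apply: contrapT => np; apply: nB; exists n%:R => x w Kx Fw.
  by rewrite leNgt; apply/negP => lt; apply: np; exists (x, w).
have [|g [go [x Kx ux]]] := Wwcompact_seq d_dual d_sep (u := fun n => (p n).1) cK.
  by move=> n; have [] := pP n.
have [||B [N _ HB]] := usc_bounded (w := fun n => (p (g n)).2) _ (KD _ Kx) ux _ df.
- by move=> k; apply: KD; have [] := pP (g k).
- by move=> k; have [] := pP (g k).
pose b := (Num.truncn `|B|).+1.
have [M _ HM] := go [set n | (b <= n)%N] (nbhs_infty_ge _).
have h1 := HB (maxn N M) (leq_maxl _ _); have h2 : (b <= g (maxn N M))%N := HM _ (leq_maxr _ _).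
have [_ _ h3] := pP (g (maxn N M)).
have h4 : B < b%:R by apply: le_lt_trans (ler_norm _) (truncnS_gt _).
have : b%:R <= (g (maxn N M))%:R :> R by rewrite ler_nat.
by move: h1 h3 h4 => /=; lra.
Qed.

End Multimap.

(** * Approximate fixed points *)

(** Cut the range of each functional into intervals of length [e]. There are finitely many cells,
    and one representative of each occupied cell forms the net. *)
Lemma bounded_net (R : realType) (T : Type) (S : set T) n (hs : nat -> T -> R) (e : R) :
  S !=set0 -> 0 < e -> (forall i, exists B : R, forall y, S y -> `|hs i y| <= B) ->
  exists (I : finType) (a : I -> T), [/\ (0 < #|I|)%N, forall i, S (a i) &
    forall y, S y -> exists i, forall j, (j < n)%N -> `|hs j y - hs j (a i)| <= e].
Proof.
move=> [s0 Ss0] e0 /choice[B HB].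
pose code j y := Num.truncn ((hs j y + B j) / e).
pose L := (\max_(j < n) Num.truncn ((B j + B j) / e))%N.
have B_ge j y : S y -> 0 <= hs j y + B j.
  by move=> Sy; have := HB j y Sy; rewrite ler_norml => /andP[]; lra.
have code_le j y : S y -> (j < n)%N -> (code j y < L.+1)%N.
  move=> Sy jn; rewrite ltnS; apply: leq_trans (leq_bigmax (Ordinal jn)).
  apply: Num.Theory.le_truncn; rewrite ler_pM2r ?invr_gt0 // lerD2r.
  exact: le_trans (ler_norm _) (HB j y Sy).
pose I : finType := {ffun 'I_n -> 'I_L.+1}.
pose P (i : I) y := S y /\ forall j : 'I_n, code j y = i j.
have /choice[a aP] : forall i : I, exists x, S x /\ ((exists y, P i y) -> P i x).
  move=> i; have [[y [Sy iy]]|ny] := pselect (exists y, P i y).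
    by exists y; split=> // _; split.
  (* Empty cells receive the default [s0], so that every index still names a point of [S]. *)
  by exists s0; split=> // /ny.
exists I, a; split=> [|i|y Sy]; first by apply/card_gt0P; exists [ffun=> ord0].
  by have [] := aP i.
exists [ffun j : 'I_n => Ordinal (code_le j y Sy (ltn_ord j))] => j jn.
set i := [ffun _ => _]; have [_ [|Sa ha]] := aP i.
  by exists y; split=> // k; rewrite ffunE.
have := ha (Ordinal jn); rewrite ffunE /= => {}ha.
have sandwich z : S z -> (code j z)%:R * e <= hs j z + B j < (code j z).+1%:R * e.
  move=> Sz; rewrite -ler_pdivlMr // -ltr_pdivrMr //; apply: Num.Theory.truncn_itv.
  by rewrite divr_ge0 ?B_ge // ltW.
have := sandwich _ Sy; have := sandwich _ Sa; rewrite ha -natr1 mulrDl mul1r ler_norml.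
by move=> /andP[h1 h2] /andP[h3 h4]; apply/andP; split; lra.
Qed.

Lemma Wconvex_setI (R : realType) (E : normedModType R) (A C : set E) :
  Wconvex A -> Wconvex C -> Wconvex (A `&` C).
Proof. by move=> cA cC x y t [Ax Cx] [Ay Cy] t01; split; [exact: cA|exact: cC]. Qed.

(* Colouring a point [x] of the simplex by an [i] such that some [y] in
   [Phi x] is close to [a i] replaces the usual appeal to the Brouwer and
   Kakutani theorems: in the limit every vertex [a i] of the face carrying [x]
   is close to a point of [Phi x]. *)
Lemma approximate_fixed_point (R : realType) (E : normedModType R) (M : set E)
  (Phi : E -> set E) (I : finType) (a : I -> E) n (hs : nat -> E -> R) (e : R) :
  Wconvex M -> (0 < #|I|)%N -> (forall i, M (a i)) -> (forall i, Wdual_fun (hs i)) ->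
  (forall x, M x -> Phi x !=set0) -> (forall x, M x -> Wconvex (Phi x)) ->
  (forall x y, M x -> Phi x y ->
     exists i, forall j, (j < n)%N -> `|hs j y - hs j (a i)| <= e) ->
  (forall (u : nat -> E) x c, (forall k, M (u k)) -> M x -> Wwcvg u x ->
     (forall k, exists2 y, Phi (u k) y & forall j, (j < n)%N -> `|hs j y - c j| <= e) ->
     exists2 y, Phi x y & forall j, (j < n)%N -> `|hs j y - c j| <= e + e) ->
  exists x y, [/\ M x, Phi x y & forall j, (j < n)%N -> `|hs j x - hs j y| <= e + e].
Proof.
move=> cM /card_gt0P[i1 _] Ma dhs Phi0 cPhi net usc.
pose comb (t : I -> R) := \sum_i t i *: a i.
have Mcomb t : simplex t -> M (comb t) by move=> st; apply: Wconvex_sum.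
pose P i t := exists2 y, Phi (comb t) y & forall j, (j < n)%N -> `|hs j y - hs j (a i)| <= e.
have [|t st Ht] := @colour_limit R I i1 P.
  move=> t st; have [y Py] := Phi0 _ (Mcomb t st).
  by have [i iy] := net _ _ (Mcomb t st) Py; exists i, y.
have /choice[y yP] : forall i, exists y, t i != 0 -> Phi (comb t) y /\
    forall j, (j < n)%N -> `|hs j y - hs j (a i)| <= e + e.
  (* Vertices of weight zero get a dummy point, which does not contribute to the sums below. *)
  move=> i; have [_|ti] := eqVneq (t i) 0; first by exists 0.
  have [u [su Pu ut]] := Ht i ti.
  have [||||y Py hy] := usc (comb \o u) (comb t) (hs ^~ (a i)).
  - by move=> k; exact: Mcomb.
  - exact: Mcomb.
  - move=> f df; rewrite /comb Wdual_sum //; under eq_fun do rewrite /= Wdual_sum //.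
    apply: cvg_big => [|k _]; first exact: add_continuous.
    by apply: cvgM => //; exact: cvg_cst.
  - exact: Pu.
  by exists y.
exists (comb t), (\sum_i t i *: y i); split; first exact: Mcomb.
  by apply: Wconvex_sum => // [|i ti]; [exact/cPhi/Mcomb|have [] := yP i ti].
move=> j jn; rewrite !(Wdual_sum _ _ (dhs j)) -sumrB.
have [t0 t1] := st; apply: le_trans (ler_norm_sum _ _ _) _.
rewrite -[leRHS]mul1r -t1 mulr_suml; apply: ler_sum => i _.
rewrite -mulrBr normrM ger0_norm //; have [->|ti] := eqVneq (t i) 0; first by rewrite !mul0r.
by apply: ler_wpM2l => //; rewrite distrC; have [_ ->] := yP i ti.
Qed.

(** * The continuation theorem *)

(** If [f] separates [x] and [y], a [d k] closer to [f] at both points than half the gap separates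
    them too. *)
Lemma Wwstar_dense_separates (R : realType) (E : normedModType R) (d : nat -> E -> R) :
  (forall f, Wdual_fun f -> forall (m : nat) (xs : nat -> E) (eps : R), 0 < eps ->
     exists k, forall i, (i < m)%N -> `|d k (xs i) - f (xs i)| < eps) ->
  forall x y : E, (forall k, d k x = d k y) -> x = y.
Proof.
move=> dd x y dxy; apply: Wdual_separates => f df; apply/eqP/negPn/negP => fxy.
have c0 : 0 < `|f x - f y| / 2 by rewrite divr_gt0 // normr_gt0 subr_eq0.
have [k hk] := dd f df 2%N (fun i => if i == 0%N then x else y) _ c0.
have := hk 0%N isT; have := hk 1%N isT; rewrite /= dxy => h1 h2.
have := ler_distD (d k y) (f x) (f y); rewrite distrC in h2; lra.
Qed.

Section LeraySchauder.
Variables (R : realType) (E : normedModType R) (d : nat -> E -> R).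
Hypothesis d_dual : forall k, Wdual_fun (d k).
Hypothesis d_sep : forall x y : E, (forall k, d k x = d k y) -> x = y.
Variables (U : set E) (x0 : E) (F : E -> set E).
Local Notation D := (Wwclosure U).
Hypothesis hF : Wseq_usc D F.
Hypothesis hne : forall x, D x -> F x !=set0.
Hypothesis hwc : forall x, D x -> Wwcompact (F x).
Hypothesis hcv : forall x, D x -> Wconvex (F x).

Definition solutions : set E := [set x | D x /\
  exists l : R, 0 <= l <= 1 /\ exists y, F x y /\ x = (1 - l) *: x0 + l *: y].

(** A point of the weak closure is the limit of a sequence of solutions; pass to a subsequence with
    convergent parameters and apply [usc_limit]. Closedness is what Urysohn's lemma requires. *)
Lemma solutions_closed : Wrel_wcompact solutions -> Wwclosed solutions.
Proof.
move=> cS; suff SS : Wwclosure solutions `<=` solutions.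
  have -> : solutions = Wwclosure solutions.
    by apply/seteqP; split=> //; exact: subset_Wwclosure.
  exact: Wwclosure_closed.
move=> x Sx; have [u [Su ux]] := Wwclosure_seq d_dual d_sep cS Sx.
have Du k : D (u k) by have [] := Su k.
have Dx : D x by apply: Wwclosed_cvg ux (nearW _ Du); exact: Wwclosure_closed.
have /choice[p pP] : forall k, exists p : R * E,
    [/\ 0 <= p.1 <= 1, F (u k) p.2 & u k = (1 - p.1) *: x0 + p.1 *: p.2].
  by move=> k; have [_ [l [l01 [y [Fy uE]]]]] := Su k; exists (l, y).
(* The index type [unit] gives the case of a single real sequence. *)
have [|g [go [t tg]]] := @bolzano_weierstrass_fin R unit (fun k _ => (p k).1).
  by move=> k _; have [/andP[l0 l1] _ _] := pP k; rewrite ger0_norm.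
have [||||||v Fv xE] := usc_limit d_dual d_sep hF hwc (u := u \o g)
  (w := fun k => (p (g k)).2) (t := fun k => (p (g k)).1) (x := x) (x0 := x0) (y := x) (s := t tt).
- by move=> k; exact: Du.
- exact: Dx.
- exact: Wwcvg_comp.
- by move=> k; have [] := pP (g k).
- exact: tg.
- move=> i; have := Wwcvg_comp go ux (d_dual i); rewrite /comp /=.
  have uE k : u (g k) = (1 - (p (g k)).1) *: x0 + (p (g k)).1 *: (p (g k)).2.
    by have [] := pP (g k).
  by under eq_fun do rewrite uE.
split=> //; exists (t tt); split; last by exists v.
apply/andP; split.
  by apply: cvgr_to_ge (tg tt) _; apply: nearW => k; have [/andP[]] := pP (g k).
by apply: cvgr_to_le (tg tt) _; apply: nearW => k; have [/andP[]] := pP (g k).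
Qed.

Variable th : E -> R.
Hypothesis th01 : forall x, 0 <= th x <= 1.
Hypothesis th_off : forall x, ~ U x -> th x = 0.
Hypothesis th_cvg : forall (u : nat -> E) x, Wwcvg u x -> th (u n) @[n --> \oo] --> th x.

(* Off [D] the constraint on [w] is void, but there [th x = 0] makes the value
   the singleton of [x0]. *)
Definition damped (x : E) : set E :=
  [set z | exists2 w, (D x -> F x w) & z = (1 - th x) *: x0 + th x *: w].

Lemma damped_off x z : ~ U x -> damped x z -> z = x0.
Proof. by move=> /th_off t0 [w _ ->]; rewrite t0 subr0 scale1r scale0r addr0. Qed.

Lemma damped_nonempty x : damped x !=set0.
Proof.
have [Dx|nD] := pselect (D x); last by exists ((1 - th x) *: x0 + th x *: x0), x0.
by have [w Fw] := hne Dx; exists ((1 - th x) *: x0 + th x *: w), w.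
Qed.

Lemma damped_convex x : Wconvex (damped x).
Proof.
move=> y z t [v Fv ->] [w Fw ->] t01.
exists (t *: v + (1 - t) *: w); first by move=> Dx; apply: hcv => //; [exact: Fv|exact: Fw].
(* Testing against the separating functionals turns the vector identity into a real one for
   [ring]. *)
apply: d_sep => k; have dk := d_dual k.
by rewrite !(WdualD _ _ dk, WdualZ _ _ dk); ring.
Qed.

(** If [u] visits [D] infinitely often, [usc_approx] applies along that subsequence. Otherwise [u]
    eventually stays off [U], so [th x = 0] and the values at [x] and far along [u] are all [x0]. *)
Lemma damped_usc (u : nat -> E) x n (hs : nat -> E -> R) (c : nat -> R) (e : R) :
  (forall i, Wdual_fun (hs i)) -> 0 < e -> Wwcvg u x ->
  (forall k, exists2 y, damped (u k) y & forall j, (j < n)%N -> `|hs j y - c j| <= e) ->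
  exists2 y, damped x y & forall j, (j < n)%N -> `|hs j y - c j| <= e + e.
Proof.
move=> dhs e0 ux H; have [often|] := pselect (forall n, exists m, (n <= m)%N /\ D (u m)).
  have [g gP] := choice often.
  have go : g @ \oo --> \oo by apply: cvg_ge_id => k; have [] := gP k.
  have Dg k : D (u (g k)) by have [] := gP k.
  have ugx : Wwcvg (u \o g) x by exact: Wwcvg_comp.
  have Dx : D x by apply: Wwclosed_cvg ugx (nearW _ Dg); exact: Wwclosure_closed.
  have /choice[w wP] : forall k, exists w, F (u (g k)) w /\ forall j, (j < n)%N ->
      `|hs j ((1 - th (u (g k))) *: x0 + th (u (g k)) *: w) - c j| <= e.
    by move=> k; have [y [w /(_ (Dg k)) Fw ->] hw] := H (g k); exists w.
  have [||v Fv hv] := usc_approx hF hwc (w := w) (x0 := x0) (n := n) (hs := hs) (c := c)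
    (e := e) (de := e) Dg Dx ugx _ (th_cvg ugx) dhs e0.
  - by move=> k; have [] := wP k.
  - by apply: nearW => k; have [] := wP k.
  by exists ((1 - th x) *: x0 + th x *: v) => //; exists v.
move=> /existsNP[N rare].
have nU m : (N <= m)%N -> ~ U (u m).
  by move=> Nm /(@subset_Wwclosure _ _ U) Dm; apply: rare; exists m.
have thx : th x = 0.
  apply/esym; have := th_cvg ux; move/cvg_lim => <- //.
  apply/esym/cvg_lim => //; apply: cvg_near_cst; exists N => // m /nU; exact: th_off.
have [y yx] := damped_nonempty x; exists y => // j jn.
have [z zN hz] := H N; have -> : y = z.
  rewrite (damped_off (nU N (leqnn N)) zN).
  by case: yx => w _ ->; rewrite thx subr0 scale1r scale0r addr0.
by apply: le_trans (hz j jn) _; rewrite lerDl ltW.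
Qed.

Definition hull : set E := [set x | forall C : set E, Wconvex C -> C x0 ->
  (forall y, C y -> damped y `<=` C) -> C x].

Lemma hull_convex : Wconvex hull.
Proof.
move=> x y t hx hy t01 C cC C0 CC; apply: (cC) => //; [exact: hx|exact: hy].
Qed.

Lemma hull_center : hull x0. Proof. by []. Qed.

Lemma hull_damped x : hull x -> damped x `<=` hull.
Proof. by move=> hx z xz C cC C0 CC; apply: (CC x) => //; exact: hx. Qed.

(** For a closed convex [C] that contains the generators, [hull] intersected with [C] is again
    convex, contains [x0] and is stable under [damped], so minimality puts [hull] inside [C]. This
    is the inclusion that hypothesis (b) asks for. *)
Lemma hull_sub_clconv :
  hull `&` D `<=` Wclconv ([set x0] `|` \bigcup_(m in hull `&` D) F m).
Proof.
move=> x [hx _] C _ cC CF.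
have C0 : C x0 by apply: CF; left.
suff [] : (hull `&` C) x by [].
apply: hx; first exact: (Wconvex_setI hull_convex cC).
  by split=> //; exact: hull_center.
move=> y [hy Cy] z yz; split; first exact: hull_damped yz.
have [Dy|nD] := pselect (D y); last first.
  by rewrite (damped_off _ yz) // => /(@subset_Wwclosure _ _ U).
case: yz => w /(_ Dy) Fw ->; rewrite addrC.
by apply: cC => //; apply: CF; right; exists y.
Qed.

Lemma fixed_damped : Wwopen U -> U x0 -> Wrel_wcompact (hull `&` D) ->
  exists x, D x /\ damped x x.
Proof.
move=> oU Ux0 cN; have [n0 [gs [e0 [dgs e0_gt0 gsU]]]] := oU x0 Ux0.
set K := Wwclosure (hull `&` D) in cN *.
have KD : K `<=` D by apply: Wwclosure_min; [exact: Wwclosure_closed|move=> x []].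
pose S := \bigcup_(x in hull) damped x.
have bndS f : Wdual_fun f -> exists B : R, forall y, S y -> `|f y| <= B.
  move=> df; have [B HB] := usc_bounded_image d_dual d_sep hF hwc cN KD df.
  exists (`|f x0| + `|B|) => y [x hx xy]; have [Dx|nD] := pselect (D x); last first.
    rewrite (damped_off _ xy) ?lerDl // => /(@subset_Wwclosure _ _ U); exact: nD.
  case: xy => w /(_ Dx) Fw ->; rewrite (WdualD _ _ df) !(WdualZ _ _ df).
  apply: le_trans (ler_normD _ _) _; have /andP[t0 t1] := th01 x.
  have u0 : 0 <= 1 - th x by rewrite subr_ge0.
  rewrite !normrM (ger0_norm u0) (ger0_norm t0); apply: lerD.
    by rewrite ler_piMl // gerBl.
  have fw : `|f w| <= `|B|.
    by apply: le_trans (ler_norm B); apply: HB Fw; exact: subset_Wwclosure.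
  by apply: le_trans fw; rewrite ler_piMl.
have S0 : S !=set0.
  by have [z z0] := damped_nonempty x0; exists z; exists x0 => //; exact: hull_center.
have Shull : S `<=` hull by move=> y [x hx]; exact: hull_damped.
(* The first [n0] functionals define a neighbourhood of [x0] inside [U], which forces approximate
   fixed points into [U]; the [d k] that follow identify the limit. *)
pose hs i := if (i < n0)%N then gs i else d (i - n0)%N.
have dhs i : Wdual_fun (hs i) by rewrite /hs; case: ifP.
have /choice[p pP] : forall j : nat, exists p : E * E, [/\ hull p.1, damped p.1 p.2 &
    forall i, (i < n0 + j)%N -> `|hs i p.1 - hs i p.2| <= j.+1%:R^-1].
  move=> j; pose e : R := j.+1%:R^-1 / 2.
  have e_gt0 : 0 < e by rewrite divr_gt0 // invr_gt0.
  have [I [a [I0 Sa net]]] := bounded_net (n0 + j) S0 e_gt0 (fun i => bndS _ (dhs i)).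
  have [|||||x [y [hx xy xye]]] := approximate_fixed_point (a := a) (n := (n0 + j)%N)
     (hs := hs) (Phi := damped) (e := e) hull_convex I0 _ dhs.
  - by move=> i; exact: Shull.
  - by move=> x _; exact: damped_nonempty.
  - by move=> x _; exact: damped_convex.
  - by move=> x y hx xy; apply: net; exists x.
  - by move=> u x c _ _ ux; exact: damped_usc.
  by exists (x, y); split=> // i ij; rewrite [leRHS]splitr; exact: xye.
have [j0 _ Hj0] := near_infty_natSinv_lt (PosNum e0_gt0).
(* Off [U] the damped value is [x0], so an approximate fixed point would be so close to [x0] that it
   lies in [U] after all. *)
have pU j : (j0 <= j)%N -> U (p j).1.
  move=> jj0; have [_ xy h] := pP j; apply: contrapT => nU; apply: (nU); apply: gsU => i ni.
  have -> : x0 = (p j).2 by rewrite (damped_off nU xy).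
  have := h i (ltn_addr _ ni); rewrite /hs ni => /le_lt_trans; apply.
  exact: Hj0.
pose q j := p (j + j0)%N.
have qU j : U (q j).1 by apply: pU; exact: leq_addl.
have qD j : D (q j).1 by exact: subset_Wwclosure (qU j).
have qK j : K (q j).1.
  by apply: subset_Wwclosure; split=> //; have [] := pP (j + j0)%N.
have [g [go [x Kx ugx]]] := Wwcompact_seq d_dual d_sep cN qK.
have Dx := KD _ Kx; exists x; split=> //.
have /choice[w wP] : forall j, exists w, F (q (g j)).1 w /\
    (q (g j)).2 = (1 - th (q (g j)).1) *: x0 + th (q (g j)).1 *: w.
  move=> j; have [_ xy _] := pP (g j + j0)%N.
  by case: xy => w /(_ (qD (g j))) Fw e; exists w.
have [|||v Fv xE] := usc_limit d_dual d_sep hF hwc (u := fun j => (q (g j)).1) (w := w)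
  (t := fun j => th (q (g j)).1) (x0 := x0) (y := x) _ Dx ugx _ (th_cvg ugx).
- by move=> j; exact: qD.
- by move=> j; have [] := wP j.
- move=> i.
  have qE k : (1 - th (q (g k)).1) *: x0 + th (q (g k)).1 *: w k = (q (g k)).2.
    by have [_ ->] := wP k.
  under eq_fun do rewrite qE.
  have dx := ugx _ (d_dual i).
  have small : (g k + j0).+1%:R^-1 @[k --> \oo] --> (0 : R).
    have sh : (fun k => (k + j0)%N) \o g @ \oo --> \oo by apply: cvg_comp go _; exact: cvg_addnr.
    exact: cvg_comp sh (@cvg_harmonic R).
  (* [d i] is functional number [n0 + i] of [hs], hence among those controlled as soon as
     [i < g k]. *)
  have diff : d i (q (g k)).1 - d i (q (g k)).2 @[k --> \oo] --> (0 : R).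
    apply/cvgr0Pnorm_le => e e_gt0; have /cvgr0Pnorm_le/(_ e e_gt0) h := small.
    have big : \forall k \near \oo, (i < g k)%N by exact: (go [set m | (i < m)%N] (nbhs_infty_gt i)).
    near=> k; apply: le_trans (_ : (g k + j0).+1%:R^-1 <= e); last first.
      by apply: le_trans (ler_norm _) _; near: k.
    have [_ _ hk] := pP (g k + j0)%N; have := hk (n0 + i)%N.
    rewrite /hs [(n0 + i < n0)%N]ltnNge leq_addr /= addKn; apply; rewrite ltn_add2l.
    by apply: leq_trans (leq_addr _ _); near: k.
  have -> : (fun k => d i (q (g k)).2) =
      (fun k => d i (q (g k)).1 - (d i (q (g k)).1 - d i (q (g k)).2)).
    by apply/funext => k; rewrite subKr.
  by rewrite -[d i x]subr0; exact: cvgB.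
by exists v.
Unshelve. all: by end_near. Qed.

End LeraySchauder.

Theorem theorem3p8 (R : realType) (E : completeNormedModType R)
  (U : set E) (x0 : E) (F : E -> set E)
  (hN : Wweakly_normal E) (hS : Wwstar_separable E)
  (hU : Wwopen U) (hx0 : U x0)
  (hF : Wseq_usc (Wwclosure U) F)
  (hne : forall x, Wwclosure U x -> F x !=set0)
  (hwc : forall x, Wwclosure U x -> Wwcompact (F x))
  (hcv : forall x, Wwclosure U x -> Wconvex (F x))
  (ha : Wrel_wcompact [set x | Wwclosure U x /\
          exists l : R, 0 <= l <= 1 /\
            exists y, F x y /\ x = (1 - l) *: x0 + l *: y])
  (hb : forall M : set E, M `<=` Wwclosure U ->
          M `<=` Wclconv ([set x0] `|` \bigcup_(m in M) F m) ->
          Wrel_wcompact M)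
  (hc : forall x, Wwclosure U x -> ~ U x -> forall l : R, 0 <= l <= 1 ->
          ~ (exists y, F x y /\ x = (1 - l) *: x0 + l *: y)) :
  exists x, Wwclosure U x /\ F x x.
Proof.
have [d [d_dual d_dense]] := hS; have d_sep := Wwstar_dense_separates d_dense.
have cS := solutions_closed d_dual d_sep hF hwc ha.
have cU : Wwclosed (~` U) by rewrite /Wwclosed setCK.
(* By (c) no solution lies outside [U], so the two closed sets are disjoint. *)
have [|th [th01 th0 th1 th_cvg]] := weak_urysohn hN cU cS.
  by rewrite -subset0 => x [nU [Dx [l [l01 h]]]]; exact: hc Dx nU l l01 h.
have [|x [Dx [w /(_ Dx) Fw xE]]] := fixed_damped d_dual d_sep hF hne hwc hcv th01 th0 th_cvg hU hx0.
  apply: hb; first by move=> x [].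
  exact: hull_sub_clconv.
(* The damped fixed point is itself a solution, with parameter [th x]. *)
have thx : th x = 1.
  by apply: th1; split=> //; exists (th x); split=> //; exists w.
exists x; split=> //; rewrite {2}xE thx subrr scale0r add0r scale1r.
exact: Fw.
Qed.
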